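(* Let $\Omega\subset\subset\mathbb{C}^n$ be a bounded domain satisfying the $(C,\alpha,r)$-cusp condition, where $C>0$, $0<\alpha<1$, $r>0$. Put \[ A:=\frac{\pi C^{1/\alpha}}{2(1/\alpha-1)}. \] Then for every negative plurisubharmonic function $\rho$ on $\Omega$ there exist constants $c>0$ and $\delta_0>0$ such that \[ \rho(z)\le -c\,\exp\!\left(-\frac{A}{\delta_\Omega(z)^{1/\alpha-1}}\right)\quad\text{for all } z\in\Omega \text{ with } \delta_\Omega(z)<\delta_0, \] where $\delta_\Omega(z)$ denotes the Euclidean distance from $z$ to $\partial\Omega$.
   Context: For a unit vector $v\in\mathbb{C}^n$, let $\langle z,w\rangle=\sum_k z_k\overline{w_k}$ and let $\pi_v$ be the orthogonal projection of $\mathbb{C}^n=\mathbb{R}^{2n}$ onto the real hyperplane $\{w:\mathrm{Re}\langle w,v\rangle=0\}$. For $p\in\mathbb{C}^n$, the $(C,\alpha)$-cusp with axis $v$ and vertex $p$ is $\Gamma(p,v,C,\alpha):=\{z\in\mathbb{C}^n:\ \mathrm{Re}\langle z-p,v\rangle>C|\pi_v(z-p)|^\alpha\}$; its axis is the ray $\{p+tv: t>0\}$. A bounded domain $\Omega\subset\mathbb{C}^n$ satisfies the $(C,\alpha,r)$-cusp condition if every $z\in\Omega$ sufficiently close to $\partial\Omega$ lies on the axis of some cusp $\Gamma(p,v,C,\alpha)$ with (1) $p\in\partial\Omega$; (2) $\Gamma(p,v,C,\alpha)\cap B_r(p)\subset\Omega$, where $B_r(p)$ is the open ball of center $p$ and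 radius $r$; (3) $|z-p|<r/2$. *)

(* Defs.v *)
From mathcomp Require Import all_boot all_order all_algebra.
From mathcomp Require Import all_classical all_reals all_analysis.
Set Implicit Arguments. Unset Strict Implicit. Unset Printing Implicit Defensive.
Import Order.TTheory GRing.Theory Num.Theory.
From mathcomp Require Import complex.
Local Open Scope ring_scope.
Local Open Scope classical_set_scope.

Section CuspDefs.
Variable R : realType.
Variable n : nat.
Local Notation V := 'rV[R[i]]_n.

Definition herm (z w : V) : R[i] := \sum_(k < n) z ord0 k * (w ord0 k)^*.

Definition cnorm (z : V) : R :=
  Num.sqrt (\sum_(k < n) ((Re (z ord0 k)) ^+ 2 + (Im (z ord0 k)) ^+ 2)).

Definition reherm (z v : V) : R := Re (herm z v).

(* orthogonal projection of R^(2n) onto the real hyperplane {w : Re<w,v> = 0},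
   for v a unit vector: pi_v(w) = w - Re<w,v> v *)
Definition proj_hyp (v w : V) : V := w - ((reherm w v)%:C)%C *: v.

Definition cusp (p v : V) (C alpha : R) : set V :=
  [set z | reherm (z - p) v > C * (cnorm (proj_hyp v (z - p))) `^ alpha].

Definition cball (p : V) (r : R) : set V := [set z | cnorm (z - p) < r].

Definition copen (O : set V) : Prop :=
  forall z, O z -> exists2 e : R, 0 < e & cball z e `<=` O.

Definition cconnected (O : set V) : Prop :=
  forall U W : set V, copen U -> copen W -> O `<=` U `|` W ->
    O `&` U `&` W = set0 -> O `&` U = set0 \/ O `&` W = set0.

Definition cbounded (O : set V) : Prop :=
  exists M : R, forall z, O z -> cnorm z <= M.

Definition bounded_domain (O : set V) : Prop :=
  O !=set0 /\ copen O /\ cconnected O /\ cbounded O.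

(* boundary of an open set: closure minus the set *)
Definition cboundary (O : set V) : set V :=
  [set p | ~ O p /\ forall e : R, 0 < e -> exists2 w, O w & cnorm (w - p) < e].

Definition dist_bd (O : set V) (z : V) : R :=
  inf [set d | exists2 p, cboundary O p & d = cnorm (z - p)].

Definition cusp_condition (O : set V) (C alpha r : R) : Prop :=
  exists2 d1 : R, 0 < d1 &
    forall z, O z -> dist_bd O z < d1 ->
      exists p v (t : R),
        [/\ cnorm v = 1, 0 < t, z = p + ((t%:C)%C *: v)
            & [/\ cboundary O p,
            cusp p v C alpha `&` cball p r `<=` O &
            cnorm (z - p) < r / 2]].

Definition circ_pt (a b : V) (t : R) : V := a + ((cos t +i* sin t)%C *: b).

Definition usc_on (O : set V) (u : V -> \bar R) : Prop :=
  forall z, O z -> forall t : R, (u z < t%:E)%E ->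
    exists2 e : R, 0 < e & forall w, O w -> cnorm (w - z) < e -> (u w < t%:E)%E.

Definition psh (O : set V) (u : V -> \bar R) : Prop :=
  [/\ forall z, O z -> u z != +oo%E,
      usc_on O u,
      (exists z, O z /\ u z != -oo%E) &
      forall a b : V, O a ->
        (forall zeta : R[i], `|zeta| <= 1 -> O (a + zeta *: b)) ->
        (u a <= ((2 * pi)^-1)%:E *
           \int[@lebesgue_measure R]_(t in `[0%R, (2 * pi)%R])
              u (circ_pt a b t))%E].

End CuspDefs.

(* Main.v *)
Require Import Defs.
From mathcomp Require Import all_boot all_order all_algebra.
From mathcomp Require Import all_classical all_reals all_analysis.
Import Order.TTheory GRing.Theory Num.Theory.
From mathcomp Require Import complex ring lra.
From mathcomp Require Import measurable_realfun.
Import numFieldNormedType.Exports.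
Set Implicit Arguments. Unset Strict Implicit. Unset Printing Implicit Defensive.
Local Open Scope ring_scope.
Local Open Scope classical_set_scope.

(** The complex line through the axis of a cusp cuts it in the planar cusp
    [D = {x + iy : x > C |y|^alpha}], on which [rho] is a negative subharmonic
    function [u].  Put [m = 1/alpha], [beta = m - 1].  On [D] we compare [u] with
    [- k Re (exp (- G))], where [G(z) = A z^-beta - K z^beta].  To first order
    [Im (A z^-beta)] equals [-+ pi/2] on the boundary [|y| = (x/C)^m] of [D], which
    is what fixes the constant [A]; the term [K z^beta] absorbs the error, so that
    near the vertex [T = {|Im G| <= pi/2}] lies inside [D].  On the sides of [T] the
    barrier vanishes, it tends to [0] at the vertex, and on the cap [x = x0] it is
    dominated by a bound [u <= -c0] which is uniform over all cusps: the caps stay in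
    the compact set of points at distance at least [eta] from the complement of
    [Omega].  The maximum principle gives [u <= - k Re (exp (- G))] on [T], hence the
    estimate on the axis.

    The maximum principle uses no complex analysis beyond second-order expansions:
    if [u + Re F + k |z|^2] had an interior maximum [a], with
    [F (a + h) = F a + c h + d h^2 + o(h^2)], then on a small circle [u] would be
    below a trigonometric polynomial of mean [< u a], against the sub-mean value
    inequality. *)

(** * Second-order expansions *)

Section Jet2.
Context {K : numFieldType}.
Implicit Types (f g q k : K^o -> K^o) (a c h : K^o).

(* Named, because over a [numFieldType] [nbhs 0] unfolds during unification and its [Filter] instance is lost. *)
Definition nbhs_zero : set_system K^o := nbhs (0 : K^o).

Global Instance nbhs_zero_filter : ProperFilter nbhs_zero.
Proof. exact: nbhs_pfilter. Qed.

Local Notation F := nbhs_zero.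

(** The coefficient of [h^2] is [q 0], and continuity of [q] at [0] makes the remainder
    [h^2 (q h - q 0)] an [o(h^2)]. Carrying [q] as a function turns sums, compositions and inverses
    into algebraic identities. *)
Definition jet2 f a := exists c q,
  q @ F --> q 0 /\ \forall h \near F, f (a + h) = f a + h * (c + h * q h).

Lemma cvg_id_zero : (fun h : K^o => h) @ F --> (0 : K^o).
Proof. exact: cvg_id. Qed.

Lemma cvg_affine k q c a (b : K^o) : k @ F --> a -> q @ F --> b ->
  (fun h => c + k h * q h) @ F --> c + a * b.
Proof. by move=> ka qb; apply: cvgD; [exact: cvg_cst|exact: cvgM]. Qed.

Lemma cvg_affine0 q c (b : K^o) : q @ F --> b -> (fun h => c + h * q h) @ F --> c.
Proof.
by move=> /(cvg_affine (c := c) cvg_id_zero); rewrite mul0r addr0.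
Qed.

Lemma jet2_continuous f a : jet2 f a -> (fun h => f (a + h)) @ F --> f a.
Proof.
move=> [c [q [cq fq]]].
apply: cvg_trans (cvg_affine0 (c := f a) (cvg_affine0 (c := c) cq)).
by apply: near_eq_cvg; near=> h; apply/esym; near: h.
Unshelve. all: by end_near. Qed.

Lemma jet2_scale (x : K) f a : jet2 f a -> jet2 (fun z => x * f z) a.
Proof.
move=> [c [q [cq fq]]]; exists (x * c), (fun h => x * q h); split.
  by apply: cvgM; [exact: cvg_cst|exact: cq].
near=> h.
have -> : f (a + h) = f a + h * (c + h * q h) by near: h.
ring.
Unshelve. all: by end_near. Qed.

Lemma jet2D f g a : jet2 f a -> jet2 g a -> jet2 (fun z => f z + g z) a.
Proof.
move=> [c [q [cq fq]]] [d [s [cs gs]]]; exists (c + d), (fun h => q h + s h).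
split; first by apply: cvgD; [exact: cq|exact: cs].
near=> h.
have -> : f (a + h) = f a + h * (c + h * q h) by near: h.
have -> : g (a + h) = g a + h * (d + h * s h) by near: h.
ring.
Unshelve. all: by end_near. Qed.

Lemma jet2_comp f g a : jet2 f a -> jet2 g (f a) -> jet2 (fun z => g (f z)) a.
Proof.
move=> [c [q [cq fq]]] [d [s [cs gs]]].
have cl := cvg_affine0 (c := c) cq.
pose k (h : K^o) : K^o := h * (c + h * q h).
have ck : k @ F --> (0 : K^o).
  have -> : (0 : K^o) = 0 * c by rewrite mul0r.
  exact: (cvgM cvg_id_zero cl).
have csk : (s \o k) @ F --> s 0 by apply: (cvg_comp _ s ck); exact: cs.
(* This is [k h * (d + k h * s (k h))] with [k h = h * (c + h * q h)], collected by powers of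
   [h]. *)
exists (d * c), (fun h => q h * d + (c + h * q h) * ((c + h * q h) * s (k h))); split.
  rewrite mul0r addr0 /k mul0r.
  by apply: cvgD; [apply: cvgM; [exact: cq|exact: cvg_cst]|apply: cvgM => //; apply: cvgM].
have gk : \forall h \near F, g (f a + k h) = g (f a) + k h * (d + k h * s (k h)).
  exact: (ck _ gs).
near=> h.
have -> : f (a + h) = f a + h * (c + h * q h) by near: h.
have -> : g (f a + h * (c + h * q h)) = g (f a) + k h * (d + k h * s (k h)) by near: h.
by rewrite /k; ring.
Unshelve. all: by end_near. Qed.

(* With [k = g (a + h) - g a], the expansion of [f] at [g a] reads [h = k * (c + k * q k)]. *)
Lemma jet2_inverse f g a : (fun h => g (a + h)) @ F --> g a ->
  (\forall h \near F, f (g (a + h)) = a + h) ->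
  (exists c q, [/\ c != 0, q @ F --> q 0 &
     \forall h \near F, f (g a + h) = f (g a) + h * (c + h * q h)]) ->
  jet2 g a.
Proof.
move=> cg fg [c [q [c0 cq fq]]].
pose k (h : K^o) : K^o := g (a + h) - g a.
have ck : k @ F --> (0 : K^o).
  have : k @ F --> g a - g a by apply: cvgB; [exact: cg|exact: cvg_cst].
  by rewrite subrr.
have fga : f (g a) = a.
  by have := @nbhs_singleton K^o _ _ fg; rewrite addr0.
have cqk : (q \o k) @ F --> q 0 by apply: (cvg_comp _ q ck); exact: cq.
pose D (h : K^o) : K^o := c + k h * q (k h).
have cD : D @ F --> c.
  by have := cvg_affine (c := c) ck cqk; rewrite mul0r addr0.
(* Since [k h / h = 1 / D h] and [D h - c = k h * q (k h)], the second-order quotient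
   [(1 / D h - 1 / c) / h] is [- q (k h) / (c * D h ^ 2)]. *)
exists c^-1, (fun h => - (q (k h) / (c * (D h * D h)))); split.
  have k0 : k 0 = 0 by rewrite /k addr0 subrr.
  rewrite /D k0 mul0r addr0 -/(D _).
  apply: cvgN; apply: cvgM => //; apply: cvgV; first by rewrite !mulf_neq0.
  by apply: cvgM; [exact: cvg_cst|exact: cvgM].
have fk : \forall h \near F, f (g a + k h) = f (g a) + k h * (c + k h * q (k h)).
  exact: (ck _ fq).
have D0 : \forall h \near F, D h != 0.
  exact: (cvgr_neq0 c).
near=> h.
have Dh0 : D h != 0 by near: h.
have gk : g (a + h) = g a + k h by rewrite /k addrCA subrr addr0.
have kE : k h = h / D h.
  have fgah : f (g (a + h)) = a + h by near: h.
  have : f (g a + k h) = f (g a) + k h * D h by near: h.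
  rewrite -gk fgah fga => /addrI hE.
  by apply: (canRL (mulfK Dh0)).
rewrite gk.
have Dc : D h = c + h / D h * q (k h) by rewrite {1}/D -kE.
rewrite {1}kE; congr (_ + _).
have := Dc; set Q := q (k h); move: (D h) Dh0 => E E0 EE.
have QE : h * Q = E * (E - c) by rewrite {2}EE; field.
have -> : h * (c^-1 + h * - (Q / (c * (E * E)))) = h * (c^-1 - (h * Q) / (c * (E * E))) by ring.
by rewrite QE; field; rewrite c0 E0.
Unshelve. all: by end_near. Qed.

End Jet2.

(** * Taylor bounds for real elementary functions *)

Section RealEstimates.
Context {R : realType}.
Implicit Types x y : R.

Lemma sin_ler x : 0 <= x -> sin x <= x.
Proof.
move=> x0; have [|z /itvP zI] := @MVT_segment R sin cos 0 x x0.
- by apply: continuous_subspaceT => z; exact: continuous_sin.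
- rewrite sin0 !subr0 => ->.
  by rewrite -[leRHS]mul1r ler_wpM2r// cos_le1.
Qed.

Lemma norm_sin_ler x : `|sin x| <= `|x|.
Proof.
have pos y : 0 <= y -> `|sin y| <= y.
  move=> y0; rewrite ler_norml sin_ler// andbT.
  have [ypi|piy] := leP y pi.
    by apply: (@le_trans _ _ 0); [rewrite oppr_le0|rewrite sin_ge0_pi// y0].
  by have := sin_geN1 y; have := pi_ge2 R; lra.
have [x0|x0] := leP 0 x; first by rewrite (ger0_norm x0) pos.
by rewrite (ltr0_norm x0) -normrN -sinN pos// oppr_ge0 ltW.
Qed.

Lemma cos_ge_sqr x : 1 - x ^+ 2 / 2 <= cos x.
Proof.
rewrite [X in cos X](_ : x = (x / 2) *+ 2); last by rewrite mulr2n; field.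
rewrite cos_mulr2n cos2sin2.
have := norm_sin_ler (x / 2).
rewrite -ler_sqr ?nnegrE// !real_normK ?num_real//.
set s := sin _ ^+ 2 => h; rewrite [X in _ <= X - 1]mulr2n; lra.
Qed.

Lemma sin_cube x : 0 <= x -> x - x ^+ 3 <= sin x.
Proof.
move=> x0.
have [|z zI] := @MVT_segment R (fun z => sin z - z) (fun z => cos z - 1) 0 x x0.
  apply: continuous_subspaceT => z; apply: cvgB; [exact: continuous_sin|exact: cvg_id].
rewrite sin0 !subr0 => e.
have {e} -> : sin x = x + (cos z - 1) * x by rewrite -e; ring.
have := cos_ge_sqr z; move: zI; rewrite in_itv/= => /andP[z0 zx] h.
have zx2 : z ^+ 2 <= x ^+ 2 by rewrite ler_sqr ?nnegrE.
have : (1 - cos z) * x <= x ^+ 2 * x.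
  by rewrite ler_wpM2r//; have := sqr_ge0 x; lra.
by rewrite exprSr; lra.
Qed.

Lemma sin_taylor x : `|sin x - x| <= `|x| ^+ 3.
Proof.
have pos y : 0 <= y -> `|sin y - y| <= y ^+ 3.
  move=> y0; rewrite ler_norml; have := sin_cube y0; have := sin_ler y0.
  have : 0 <= y ^+ 3 by exact: exprn_ge0.
  by move=> *; apply/andP; split; lra.
have [x0|x0] := leP 0 x; first by rewrite (ger0_norm x0) pos.
rewrite (ltr0_norm x0) -normrN opprB.
have -> : x - sin x = sin (- x) - (- x) by rewrite sinN; ring.
by rewrite pos// oppr_ge0 ltW.
Qed.

Lemma cos_taylor x : `|x| <= 1 -> `|cos x - 1 + x ^+ 2 / 2| <= `|x| ^+ 3.
Proof.
move=> x1.
rewrite -(real_normK (num_real x)) -(cos_norm x); move: (`|x|) (normr_ge0 x) x1 => {}x x0 x1.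
have -> : cos x = 1 - 2 * sin (x / 2) ^+ 2.
  rewrite [X in cos X](_ : x = (x / 2) *+ 2); last by rewrite mulr2n; field.
  by rewrite cos_mulr2n cos2sin2 mulr2n; ring.
have x20 : 0 <= x / 2 by lra.
have := sin_ler x20; have := sin_cube x20.
have s0 : 0 <= sin (x / 2).
  by rewrite sin_ge0_pi// x20/= (le_trans _ (pi_ge2 R))//; lra.
move: (sin _) s0 => s s0 s1 s2.
have h1 : s ^+ 2 <= (x / 2) ^+ 2 by rewrite ler_sqr ?nnegrE.
have h2 : (x / 2) ^+ 2 - 2 * (x / 2) * (x / 2) ^+ 3 <= s ^+ 2 by nra.
have h3 : x ^+ 4 <= x ^+ 3 by rewrite exprSr ler_piMr// exprn_ge0.
have x30 : 0 <= x ^+ 3 by rewrite exprn_ge0.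
have -> : 1 - 2 * s ^+ 2 - 1 + x ^+ 2 / 2 = 2 * ((x / 2) ^+ 2 - s ^+ 2) by field.
rewrite ler_norml; apply/andP; split; first lra.
have : 2 * (x / 2) * (x / 2) ^+ 3 = x ^+ 4 / 8 by field.
lra.
Qed.

(** From [1 - x <= exp (- x)], together with [(1 - x) (1 + x + 2 x^2) = 1 + x^2 (1 - 2 x) >= 1]. *)
Lemma expR_ler x : `|x| <= 1 / 2 -> expR x <= 1 + x + 2 * x ^+ 2.
Proof.
move=> x2.
have := expR_ge1Dx (- x); rewrite expRN => h.
have e0 := expR_gt0 x.
move: x2; rewrite ler_norml => /andP[xl xr].
have : (1 - x) * expR x <= 1.
  by rewrite -ler_pdivlMr// mul1r.
move: (expR x) e0 => e e0 h2.
suff : (1 - x) * e <= (1 - x) * (1 + x + 2 * x ^+ 2) by rewrite ler_pM2l//; lra.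
by apply: (le_trans h2); have := sqr_ge0 x; nra.
Qed.

Lemma expR_taylor x : `|x| <= 1 / 2 ->
  `|expR x - (1 + x + x ^+ 2 / 2)| <= 2 * `|x| ^+ 3.
Proof.
move=> x2.
pose f (z : R) := expR z - (1 + z + z ^+ 2 / 2).
pose df (z : R) := expR z - (1 + z).
have fd (z : R) : is_derive z 1 f (df z).
  rewrite /f /df; apply: is_derive_eq.
  by rewrite !scaler0 /GRing.scale/=; field.
have dfb z : `|z| <= `|x| -> `|df z| <= 2 * `|x| ^+ 2.
  move=> zx; have zx2 : z ^+ 2 <= `|x| ^+ 2.
    by rewrite -(real_normK (num_real z)) ler_sqr ?nnegrE.
  have := expR_ge1Dx z; have := expR_ler (le_trans zx x2).
  move=> h1 h2; rewrite /df ger0_norm; lra.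
have fc (a b : R) : {within `[a, b], continuous f}.
  apply: derivable_within_continuous => z _.
  by have [] := fd z.
have f0 : f 0 = 0 by rewrite /f expR0; field.
rewrite -/(f x) exprSr mulrA.
have [x0|x0] := leP 0 x.
  have [c] := MVT_segment x0 (fun z _ => fd z) (fc 0 x).
  rewrite in_itv/= => /andP[c0 cx]; rewrite f0 !subr0 => ->.
  by rewrite normrM ler_wpM2r// dfb// !ger0_norm.
have [c] := MVT_segment (ltW x0) (fun z _ => fd z) (fc x 0).
rewrite in_itv/= => /andP[cx c0]; rewrite f0 !sub0r => fE.
rewrite -normrN fE normrM normrN ler_wpM2r// dfb//.
by rewrite !ler0_norm// ?lerN2// ltW.
Qed.

Lemma atan_bounds x : 0 <= x -> x / (1 + x ^+ 2) <= atan x <= x.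
Proof.
move=> x0.
have [|c] := @MVT_segment R atan (fun z => (1 + z ^+ 2)^-1) 0 x x0.
  by apply: continuous_subspaceT => z; exact: continuous_atan.
rewrite atan0 !subr0 in_itv/= => /andP[c0 cx] ->.
have c2 : 0 <= c ^+ 2 by exact: sqr_ge0.
have x2 : 0 <= x ^+ 2 by exact: sqr_ge0.
rewrite [leLHS]mulrC; apply/andP; split.
  rewrite ler_wpM2r// lef_pV2 ?posrE; [|lra|lra].
  by rewrite lerD2l ler_sqr.
by rewrite ler_piMl// invf_le1; lra.
Qed.

End RealEstimates.

(** * Complex exponential and logarithm *)

Section ComplexExp.
Context {R : realType}.
Local Notation C := R[i].
Local Open Scope complex_scope.
Local Notation normc := ComplexField.Normc.normc.
Implicit Types (z w h : C).

Lemma normc_realE z : `|z| = (normc z)%:C. Proof. by []. Qed.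

Lemma normc_ge0 z : 0 <= normc z.
Proof. by case: z => a b; exact: sqrtr_ge0. Qed.

Lemma sqr_normcE z : normc z ^+ 2 = Re z ^+ 2 + Im z ^+ 2.
Proof. by case: z => a b; rewrite /= sqr_sqrtr// addr_ge0// sqr_ge0. Qed.

Lemma ler_normRe z : `|Re z| <= normc z.
Proof.
rewrite -ler_sqr ?nnegrE ?normc_ge0// real_normK ?num_real// sqr_normcE.
by rewrite lerDl sqr_ge0.
Qed.

Lemma ler_normIm z : `|Im z| <= normc z.
Proof.
rewrite -ler_sqr ?nnegrE ?normc_ge0// real_normK ?num_real// sqr_normcE.
by rewrite lerDr sqr_ge0.
Qed.

Lemma normc_le z : normc z <= `|Re z| + `|Im z|.
Proof.
rewrite -ler_sqr ?nnegrE ?normc_ge0 ?addr_ge0// sqr_normcE.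
rewrite sqrrD !real_normK ?num_real// addrAC lerDl.
by rewrite mulrn_wge0// mulr_ge0.
Qed.

Lemma normc_realc (x : R) : normc x%:C = `|x|.
Proof. by rewrite /= expr0n addr0 sqrtr_sqr. Qed.

Lemma nbhs_zeroP (P : C -> Prop) : (\forall h \near nbhs_zero, P h) <->
  exists2 e : R, 0 < e & forall h, normc h < e -> P h.
Proof.
rewrite /nbhs_zero; split.
  move=> /(@nbhs_normP _ C^o) [e /= e0 Pe].
  (* In the order of [R[i]], [0 < e] forces [Im e = 0], so [Re e] is a real radius. *)
  move: e0; rewrite ltcE => /andP[/eqP/= e0 e1].
  exists (Re e) => // h he; apply: Pe => /=.
  by rewrite /ball_ /= sub0r normrN normc_realE ltcE/= e0 eqxx.
move=> [e e0 Pe]; apply/(@nbhs_normP _ C^o); exists e%:C => /=; first by rewrite ltcR.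
by move=> h /=; rewrite /ball_ /= sub0r normrN normc_realE ltcR; exact: Pe.
Qed.

Lemma cvg_zeroP (q : C -> C) (l : C) :
  ((q : C^o -> C^o) @ nbhs_zero --> (l : C^o)) <->
  (forall e : R, 0 < e -> exists2 d : R, 0 < d &
     forall h, normc h < d -> normc (q h - l) < e).
Proof.
split=> [ql e e0|H].
  apply/nbhs_zeroP; move/(@cvgrPdist_lt _ C^o) : ql => /(_ e%:C).
  rewrite ltcR => /(_ e0); apply: filterS => h.
  by rewrite normc_realE ltcR -normcN opprB.
apply/(@cvgrPdist_lt _ C^o) => e; rewrite ltcE => /andP[/eqP/= e0 e1].
apply/nbhs_zeroP; have [d d0 dq] := H _ e1; exists d => // h /dq.
by rewrite normc_realE ltcE/= e0 eqxx/= -normcN opprB.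
Qed.

Lemma cvg_Re (q : C -> C) (l : C) : ((q : C^o -> C^o) @ nbhs_zero --> (l : C^o)) ->
  (fun h => Re (q h)) @ nbhs_zero --> Re l.
Proof.
move=> /cvg_zeroP ql; apply/cvgrPdist_lt => e e0; apply/nbhs_zeroP.
have [d d0 dq] := ql _ e0; exists d => // h /dq; apply: le_lt_trans.
rewrite distrC; apply: le_trans (ler_normRe _).
by case: (q h) => a b; case: (l).
Qed.

Lemma cvg_Im (q : C -> C) (l : C) : ((q : C^o -> C^o) @ nbhs_zero --> (l : C^o)) ->
  (fun h => Im (q h)) @ nbhs_zero --> Im l.
Proof.
move=> /cvg_zeroP ql; apply/cvgrPdist_lt => e e0; apply/nbhs_zeroP.
have [d d0 dq] := ql _ e0; exists d => // h /dq; apply: le_lt_trans.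
rewrite distrC; apply: le_trans (ler_normIm _).
by case: (q h) => a b; case: (l).
Qed.

Lemma cvg_shift z : ((fun h => z + h) : C^o -> C^o) @ nbhs_zero --> (z : C^o).
Proof.
by apply/cvg_zeroP => e e0; exists e => // h he; rewrite addrC addKr.
Qed.

Definition cexp z : C := (expR (Re z) * cos (Im z)) +i* (expR (Re z) * sin (Im z)).

Lemma cexpD z w : cexp (z + w) = cexp z * cexp w.
Proof.
case: z => a b; case: w => c d; rewrite /cexp /= expRD cosD sinD.
by apply/eqP; rewrite eq_complex/=; apply/andP; split; apply/eqP; ring.
Qed.

Lemma cexp_neq0 z : cexp z != 0.
Proof.
rewrite eq_complex/= !mulf_eq0 !expR_eq0/=.
apply/negP => /andP[/eqP c0 /eqP s0].
have := cos2Dsin2 (Im z); rewrite c0 s0 !expr0n addr0 => /eqP.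
by rewrite eq_sym oner_eq0.
Qed.

Lemma cexp_taylor h : normc h <= 1 / 2 ->
  normc (cexp h - (1 + h + h ^+ 2 / 2)) <= 20 * normc h ^+ 3.
Proof.
case: h => x y; set M := normc _ => M2.
have yM : `|y| <= M := ler_normIm (x +i* y).
have xM : `|x| <= M := ler_normRe (x +i* y).
have M0 : 0 <= M by exact: le_trans yM.
apply: (le_trans (normc_le _)).
have -> : (x +i* y) ^+ 2 / 2 = ((x ^+ 2 - y ^+ 2) / 2) +i* (x * y) :> C.
  rewrite -[2](_ : 2%:C = 2); last by rewrite rmorphMn rmorph1.
  apply/eqP; rewrite eq_complex expr2/= !expr0n/=.
  by apply/andP; split; apply/eqP; field.
rewrite /cexp /= add0r.
have x2 : `|x| <= 1 / 2 by exact: le_trans M2.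
have y2 : `|y| <= 1 by lra.
have := expR_taylor x2; have := cos_taylor y2; have := sin_taylor y.
have M3 (z : R) : `|z| <= M -> `|z| ^+ 3 <= M ^+ 3.
  by move=> zM; rewrite ler_pXn2r ?nnegrE.
set r3 := sin y - y; set r2 := cos y - 1 + y ^+ 2 / 2.
set r1 := expR x - (1 + x + x ^+ 2 / 2) => h3 h2 h1.
have {}h1 : `|r1| <= 2 * M ^+ 3 by apply: (le_trans h1); rewrite ler_pM2l// M3.
have {}h2 : `|r2| <= M ^+ 3 by apply: (le_trans h2); rewrite M3.
have {}h3 : `|r3| <= M ^+ 3 by apply: (le_trans h3); rewrite M3.
have e4 : `|expR x| <= 4.
  rewrite ger0_norm ?expR_ge0//; apply: (le_trans (expR_ler x2)).
  move: (x2) => /ler_normlP[xa xb].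
  have : x ^+ 2 <= 1 / 4.
    rewrite -(real_normK (num_real x)).
    have -> : 1 / 4 = (1 / 2) ^+ 2 :> R by field.
    by rewrite ler_pXn2r ?nnegrE//.
  lra.
have M30 : 0 <= M ^+ 3 by rewrite exprn_ge0.
have M43 : M ^+ 4 <= M ^+ 3 / 2.
  by rewrite exprSr ler_wpM2l//; lra.
have bM (u v a b : R) : `|u| <= a -> `|v| <= b -> `|u * v| <= a * b.
  by move=> ua vb; rewrite normrM ler_pM.
(* Substituting the real expansions leaves only terms of degree at least three; the real and the
   imaginary part contribute at most [10 * M ^+ 3] each. *)
have -> : expR x * cos y - (1 + x + (x ^+ 2 - y ^+ 2) / 2) =
    - (x * (y * y) / 2) - (x * x * (y * y) / 4) + r1 * (1 - y ^+ 2 / 2) + expR x * r2.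
  by rewrite /r1 /r2; field.
have -> : expR x * sin y - (y + x * y) =
    x * (x * y) / 2 + r1 * y + expR x * r3.
  by rewrite /r1 /r3; field.
have b1 : `|x * (y * y)| <= M ^+ 3 by rewrite !exprS expr0 mulr1 !bM.
have b2 : `|x * x * (y * y)| <= M ^+ 3 / 2.
  apply: le_trans M43; have -> : M ^+ 4 = M * M * (M * M) by ring.
  by rewrite !bM.
have b3 : `|r1 * (1 - y ^+ 2 / 2)| <= 2 * M ^+ 3.
  rewrite -[leRHS]mulr1 bM// ler_norml.
  have : y ^+ 2 <= 1 by rewrite -(real_normK (num_real y)) expr_le1.
  by have := sqr_ge0 y; move=> *; apply/andP; split; lra.
have b4 : `|expR x * r2| <= 4 * M ^+ 3 by rewrite bM.
have b5 : `|x * (x * y)| <= M ^+ 3 by rewrite !exprS expr0 mulr1 !bM.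
have b6 : `|r1 * y| <= 2 * M ^+ 3 * 1 by rewrite bM.
have b7 : `|expR x * r3| <= 4 * M ^+ 3 by rewrite bM.
move: b1 b2 b3 b4 b5 b6 b7; rewrite !ler_norml.
set u1 := x * (y * y); set u2 := x * x * (y * y); set u3 := r1 * (1 - _).
set u4 := _ * r2; set u5 := x * (x * y); set u6 := r1 * y; set u7 := _ * r3.
move=> /andP[? ?] /andP[? ?] /andP[? ?] /andP[? ?] /andP[? ?] /andP[? ?] /andP[? ?].
have k1 : `|- (u1 / 2) - u2 / 4 + u3 + u4| <= 10 * M ^+ 3.
  by rewrite ler_norml; apply/andP; split; lra.
have k2 : `|u5 / 2 + u6 + u7| <= 10 * M ^+ 3.
  by rewrite ler_norml; apply/andP; split; lra.
lra.
Qed.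

(** The functional equation reduces the expansion at [z] to the one at [0]. The nonvanishing of the
    first coefficient is recorded because inverting the expansion for [clog] needs it. *)
Lemma jet_cexp_explicit z : exists (c : C) (q : C -> C),
  [/\ c != 0, (q : C^o -> C^o) @ nbhs_zero --> (q 0 : C^o) &
    forall h, cexp (z + h) = cexp z + h * (c + h * q h)].
Proof.
(* The value [1 / 2] at [0] is the limit of the quotient, which makes [q] continuous there. *)
pose q h : C := if h == 0 then 1 / 2 else (cexp h - 1 - h) / (h * h).
exists (cexp z), (fun h => cexp z * q h); split; first exact: cexp_neq0.
  apply: (@cvgM C); first exact: cvg_cst.
  apply/cvg_zeroP => e e0; exists (Num.min (1 / 2) (e / 20)).
    by rewrite lt_min; apply/andP; split; lra.
  move=> h; rewrite lt_min => /andP[h1 h2].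
  rewrite /q eqxx; case: eqP => [|/eqP h0].
    by rewrite subrr ComplexField.Normc.normc0.
  have -> : (cexp h - 1 - h) / (h * h) - 1 / 2 = (cexp h - (1 + h + h ^+ 2 / 2)) / (h * h).
    by field.
  have nh : 0 < normc h.
    rewrite lt_neqAle normc_ge0 andbT eq_sym.
    by apply: contra h0 => /eqP/ComplexField.Normc.eq0_normc ->.
  rewrite ComplexField.Normc.normcM ComplexField.Normc.normcV ComplexField.Normc.normcM.
  rewrite ltr_pdivrMr ?mulr_gt0//; apply: (le_lt_trans (cexp_taylor (ltW h1))).
  have -> : 20 * normc h ^+ 3 = 20 * normc h * (normc h * normc h) by ring.
  rewrite ltr_pM2r ?mulr_gt0//; lra.
move=> h; rewrite cexpD /q; case: eqP => [->|/eqP h0]; last by field.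
rewrite !mul0r addr0.
suff -> : cexp 0 = 1 by rewrite mulr1.
by rewrite /cexp /= expR0 cos0 sin0 mulr0 mul1r.
Qed.

Lemma jet2_cexp z : jet2 (cexp : C^o -> C^o) z.
Proof.
have [c [q [_ cq qE]]] := jet_cexp_explicit z; exists c, q; split => //.
by near=> h; exact: qE.
Unshelve. all: by end_near. Qed.

(** On the half-plane [0 < Re z] this is the principal logarithm: there [atan (Im z / Re z)] is the
    argument. *)
Definition clog z : C := (ln (normc z)) +i* (atan (Im z / Re z)).

Lemma normc_gt0 z : 0 < Re z -> 0 < normc z.
Proof.
by move=> z0; apply: lt_le_trans (ler_normRe z); rewrite gtr0_norm.
Qed.

Lemma normc_atan z : 0 < Re z ->
  normc z * cos (atan (Im z / Re z)) = Re z /\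
  normc z * sin (atan (Im z / Re z)) = Im z.
Proof.
move=> z0; set t := Im z / Re z.
have c0 : cos (atan t) != 0.
  by rewrite gt_eqF// cos_gt0_pihalf// atan_gtNpi2 atan_ltpi2.
have e1 : normc z * cos (atan t) = Re z.
  rewrite cos_atan.
  have -> : normc z = Re z * Num.sqrt (1 + t ^+ 2).
    apply/eqP; rewrite -(@eqrXn2 _ 2)// ?normc_ge0//; last by rewrite mulr_ge0 ?sqrtr_ge0// ltW.
    rewrite sqr_normcE exprMn sqr_sqrtr ?addr_ge0 ?sqr_ge0// /t.
    by apply/eqP; field; rewrite gt_eqF.
  by rewrite mulfK// gt_eqF// sqrtr_gt0 ltr_wpDr// sqr_ge0.
split => //.
have : sin (atan t) = t * cos (atan t) by rewrite -{2}(atanK t) /tan divfK.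
move=> ->; rewrite mulrCA e1 /t divfK// gt_eqF//.
Qed.

Lemma clogK z : 0 < Re z -> cexp (clog z) = z.
Proof.
move=> z0; have [e1 e2] := normc_atan z0.
rewrite /cexp /clog /= lnK ?posrE ?normc_gt0// e1 e2.
by case: z {z0 e1 e2}.
Qed.

(** Near [z], [clog] is a continuous right inverse of [cexp], whose derivative does not vanish, so
    [jet2_inverse] applies. *)
Lemma jet2_clog z : 0 < Re z -> jet2 (clog : C^o -> C^o) z.
Proof.
move=> z0.
have cRe := cvg_Re (@cvg_shift z); have cIm := cvg_Im (@cvg_shift z).
apply: (@jet2_inverse C cexp).
- have cn : (fun h : C => ln (normc (z + h))) @ nbhs_zero --> ln (normc z).
    apply: (@cvg_comp _ _ _ (fun h : C => normc (z + h)) (@ln R)); last first.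
      by apply: continuous_ln; exact: normc_gt0.
    apply/cvgrPdist_lt => e e0; apply/nbhs_zeroP; exists e => // h he.
    apply: le_lt_trans he.
    have := le_normcD z h; have := le_normcD (z + h) (- h).
    rewrite addrK normcN ler_norml => *; apply/andP; split; lra.
  have ca : (fun h : C => atan (Im (z + h) / Re (z + h))) @ nbhs_zero -->
      atan (Im z / Re z).
    apply: (@cvg_comp _ _ _ (fun h : C => Im (z + h) / Re (z + h)) (@atan R)); last first.
      exact: continuous_atan.
    by apply: (cvgM cIm); apply: cvgV cRe; rewrite gt_eqF.
  apply/cvg_zeroP => e e0.
  have e2 : 0 < e / 2 by rewrite divr_gt0.
  move/cvgrPdist_lt : cn => /(_ _ e2) cn.
  move/cvgrPdist_lt : ca => /(_ _ e2) ca.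
  apply/nbhs_zeroP; near=> h.
  apply: (le_lt_trans (normc_le _)).
  rewrite /clog/= [ltRHS](_ : e = e / 2 + e / 2); last by field.
  by apply: ltrD; rewrite distrC; near: h.
- have Re0 := cvgr_gt _ cRe _ z0.
  have /nbhs_zeroP[e e0 He] := Re0 nbhs_zero_filter; apply/nbhs_zeroP; exists e => // h he.
  by apply: clogK; exact: He.
- have [c [q [c0 cq qE]]] := jet_cexp_explicit (clog z); exists c, q; split => //.
  by near=> h; exact: qE.
Unshelve. all: by end_near. Qed.

End ComplexExp.

(** * Maxima of upper semicontinuous functions *)

Section Cnorm.
Context {R : realType} {n : nat}.
Local Notation C := R[i].
Local Notation V := 'rV[C]_n.
Local Open Scope complex_scope.
Local Notation normc := ComplexField.Normc.normc.
Implicit Types (u v w z : V) (c : C).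

Lemma sqr_cnorm z : cnorm z ^+ 2 = \sum_(k < n) normc (z ord0 k) ^+ 2.
Proof.
rewrite /cnorm sqr_sqrtr; last by apply: sumr_ge0 => k _; rewrite addr_ge0 ?sqr_ge0.
by apply: eq_bigr => k _; rewrite sqr_normcE.
Qed.

Lemma cnorm_ge0 z : 0 <= cnorm z. Proof. exact: sqrtr_ge0. Qed.

Lemma cnormZ c z : cnorm (c *: z) = normc c * cnorm z.
Proof.
apply/eqP; rewrite -(@eqrXn2 _ 2)// ?cnorm_ge0 ?mulr_ge0 ?normc_ge0 ?cnorm_ge0//.
apply/eqP; rewrite exprMn !sqr_cnorm mulr_sumr; apply: eq_bigr => k _.
by rewrite mxE ComplexField.Normc.normcM exprMn.
Qed.

Lemma cnormN z : cnorm (- z) = cnorm z.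
Proof.
by rewrite -scaleN1r cnormZ normcN ComplexField.Normc.normc1 mul1r.
Qed.

Lemma rehermE z w : reherm z w =
  \sum_(k < n) (Re (z ord0 k) * Re (w ord0 k) + Im (z ord0 k) * Im (w ord0 k)).
Proof.
rewrite /reherm /herm (@raddf_sum _ _ (@Re R : {additive C -> R})).
apply: eq_bigr => k _; case: (z _ _) => a b; case: (w _ _) => c d /=.
by rewrite mulrN opprK.
Qed.

Lemma rehermDl u v w : reherm (u + v) w = reherm u w + reherm v w.
Proof.
rewrite !rehermE -big_split/=; apply: eq_bigr => k _; rewrite mxE.
by case: (u _ _) => a b; case: (v _ _) => c d /=; ring.
Qed.

Lemma sqr_cnormD z w : cnorm (z + w) ^+ 2 = cnorm z ^+ 2 + 2 * reherm z w + cnorm w ^+ 2.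
Proof.
rewrite !sqr_cnorm rehermE mulr_sumr -!big_split/=; apply: eq_bigr => k _.
rewrite !sqr_normcE mxE.
by case: (z _ _) => a b; case: (w _ _) => c d /=; ring.
Qed.

Lemma rehermZ (a b : R) z w : reherm (a%:C *: z) (b%:C *: w) = a * b * reherm z w.
Proof.
rewrite !rehermE mulr_sumr; apply: eq_bigr => k _; rewrite !mxE.
by case: (z _ _) => x y; case: (w _ _) => x' y' /=; ring.
Qed.

Lemma cnorm0 : cnorm (0 : V) = 0.
Proof. by rewrite -(scale0r (0 : V)) cnormZ ComplexField.Normc.normc0 mul0r. Qed.

Lemma cnorm_eq0 z : cnorm z = 0 -> z = 0.
Proof.
move=> z0; have : cnorm z ^+ 2 = 0 by rewrite z0 expr0n.
rewrite sqr_cnorm => /eqP; rewrite psumr_eq0; last by move=> k _; exact: sqr_ge0.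
move/allP => H; apply/rowP => k; rewrite mxE.
have := H k (mem_index_enum _); rewrite expf_eq0/= => /eqP.
exact: ComplexField.Normc.eq0_normc.
Qed.

Lemma reherm0 z w : cnorm z = 0 \/ cnorm w = 0 -> reherm z w = 0.
Proof.
by rewrite rehermE => -[] /cnorm_eq0 ->; apply: big1 => k _; rewrite mxE/= ?mul0r ?mulr0 addr0.
Qed.

Lemma reherm_le z w : reherm z w <= cnorm z * cnorm w.
Proof.
have [z0|z0] := eqVneq (cnorm z) 0; first by rewrite reherm0 ?z0 ?mul0r//; left.
have [w0|w0] := eqVneq (cnorm w) 0; first by rewrite reherm0 ?w0 ?mulr0//; right.
have zp : 0 < cnorm z by rewrite lt_def z0 cnorm_ge0.
have wp : 0 < cnorm w by rewrite lt_def w0 cnorm_ge0.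
(* Cauchy-Schwarz: the square of [|w| z - |z| w] equals [2 |z| |w| (|z| |w| - Re <z, w>)]. *)
have := sqr_ge0 (cnorm ((cnorm w)%:C *: z + (- cnorm z)%:C *: w)).
rewrite sqr_cnormD rehermZ !cnormZ !normc_realc normrN !ger0_norm ?cnorm_ge0//.
set a := cnorm z in zp *; set b := cnorm w in wp *; set s := reherm z w => h.
have : 0 <= 2 * (a * b) * (a * b - s) by move: h; congr (_ <= _); ring.
by rewrite pmulr_rge0 ?subr_ge0// !mulr_gt0.
Qed.

Lemma norm_reherm_le z w : `|reherm z w| <= cnorm z * cnorm w.
Proof.
rewrite ler_norml reherm_le andbT lerNl -(cnormN z); apply: le_trans (reherm_le _ _).
by rewrite !rehermE -sumrN; apply: ler_sum => k _; rewrite mxE/=; case: (z _ _) => a b/=; rewrite !mulNr opprD.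
Qed.

Lemma ler_cnormD z w : cnorm (z + w) <= cnorm z + cnorm w.
Proof.
rewrite -ler_sqr ?nnegrE ?addr_ge0 ?cnorm_ge0// sqr_cnormD sqrrD lerD2r lerD2l.
by rewrite mulr_natl lerMn2r reherm_le.
Qed.

Lemma reherm_scale c v : cnorm v = 1 -> reherm (c *: v) v = Re c.
Proof.
move=> v1; have : cnorm v ^+ 2 = 1 by rewrite v1 expr1n.
rewrite sqr_cnorm rehermE => e; rewrite -[RHS]mulr1 -e mulr_sumr.
apply: eq_bigr => k _; rewrite mxE sqr_normcE.
by case: c => a b; case: (v _ _) => x y /=; ring.
Qed.

End Cnorm.

Section UpperSemicontinuous.
Context {R : realType}.
Local Notation C := R[i].
Local Open Scope complex_scope.
Local Notation normc := ComplexField.Normc.normc.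

Lemma seq_argmax (T : eqType) (d : Order.disp_t) (S : orderType d) (f : T -> S) (s : seq T) :
  s != [::] -> exists2 x, x \in s & forall y, y \in s -> (f y <= f x)%O.
Proof.
elim: s => // a s IH _; have [->|s0] := eqVneq s [::].
  by exists a; rewrite ?inE// => y; rewrite inE => /eqP ->.
have [x xs xm] := IH s0; have [fa|fa] := leP (f a) (f x).
  by exists x; rewrite ?inE ?xs ?orbT// => y; rewrite inE => /orP[/eqP ->//|/xm].
exists a; rewrite ?inE ?eqxx// => y; rewrite inE => /orP[/eqP ->//|/xm yx].
exact: le_trans yx (ltW fa).
Qed.

(** Upper semicontinuity is phrased with real thresholds, so strict inequalities in [\bar R] must be
    separated by a real number. *)
Lemma lte_EFin_between (x y : \bar R) : (x < y)%E -> exists r : R, (x < r%:E <= y)%E.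
Proof.
case: y => [r||]; first by move=> xr; exists r; rewrite xr lexx.
  case: x => // [s _|_]; last by exists 0; rewrite ltNy0 leey.
  by exists (s + 1); rewrite lte_fin ltrDl ltr01 leey.
by rewrite ltNge leNye.
Qed.

(** Without a maximum, every [x] has some [s x] in [K] with [g x < g (s x)], and the sets
    [g < g (s x)] cover [K]. In a finite subcover take the index with the largest [g (s x)]: its
    point [s x] is covered by no member. *)
Lemma compact_usc_argmax (T : ptopologicalType) (K : set T) (g : T -> \bar R) :
  compact K -> K !=set0 ->
  (forall x (t : R), K x -> (g x < t%:E)%E -> \forall y \near x, K y -> (g y < t%:E)%E) ->
  exists2 x, K x & forall y, K y -> (g y <= g x)%E.
Proof.
move=> cK [x0 Kx0] gusc; apply: contrapT => nomax.
have {}nomax x : K x -> exists y, K y /\ (g x < g y)%E.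
  move=> Kx; apply: contrapT => H; apply: nomax; exists x => // y Ky.
  by rewrite leNgt; apply/negP => gxy; apply: H; exists y.
have /choice[s sP] : forall x, exists y, K x -> K y /\ (g x < g y)%E.
  by move=> x; have [/nomax[y ?]|nK] := pselect (K x); [exists y|exists x].
pose U x := [set y | K y -> (g y < g (s x))%E]°.
move: cK; rewrite compact_cover => /(_ _ K U (fun _ _ => @open_interior _ _)).
have KU : K `<=` cover K U.
  move=> x Kx; exists x => //=; rewrite /U /interior.
  have [_ gx] := sP _ Kx; have [r /andP[xr ry]] := lte_EFin_between gx.
  by apply: filterS (gusc _ _ Kx xr) => y /= Hy Ky; exact: lt_le_trans (Hy Ky) ry.
move=> /(_ KU)[D' D'K KD'].
have D'0 : finmap.enum_fset D' != [::].
  have [i /= iD' _] := KD' _ Kx0; apply/eqP => E.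
  by have : i \in finmap.enum_fset D' := iD'; rewrite E.
have [x xD' xmax] := seq_argmax (fun x => g (s x)) D'0.
have Kx : K x by have := D'K _ xD'; rewrite inE.
have [Ksx _] := sP _ Kx.
have [i /= iD' Ui] := KD' _ Ksx.
have := interior_subset Ui Ksx; rewrite ltNge.
by rewrite (xmax _ iD').
Qed.

Definition cclosed (n : nat) (K : set 'rV[C]_n) :=
  forall z, (forall e : R, 0 < e -> exists2 w, K w & cnorm (w - z) < e) -> K z.

(** Real and imaginary parts identify ['rV[C]_n] with ['rV[R]_(n + n)], where a closed subset of a
    box is compact. *)
Lemma usc_on_argmax (n : nat) (K : set 'rV[C]_n) (g : 'rV[C]_n -> \bar R) :
  cbounded K -> cclosed K -> K !=set0 -> usc_on K g ->
  exists2 z, K z & forall w, K w -> (g w <= g z)%E.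
Proof.
move=> [M KM] Kcl [z0 Kz0] gusc.
pose phi (x : 'rV[R]_(n + n)) : 'rV[C]_n :=
  \row_k (x ord0 (lshift n k) +i* x ord0 (rshift n k)).
pose psi (z : 'rV[C]_n) : 'rV[R]_(n + n) :=
  row_mx (\row_k Re (z ord0 k)) (\row_k Im (z ord0 k)).
have psiK z : phi (psi z) = z.
  by apply/rowP => k; rewrite mxE row_mxEl row_mxEr !mxE/=; case: (z _ _).
have phinear x (e : R) : 0 < e -> \forall y \near x, cnorm (phi y - phi x) < e.
  move=> e0; pose d := e / (2 * n.+1%:R).
  have n0 : (0 : R) < n.+1%:R by rewrite ltr0n.
  have d0 : 0 < d by rewrite divr_gt0// mulr_gt0.
  apply/nbhs_ballP; exists d => //= y [_ xy].
  rewrite -ltr_sqr ?nnegrE ?cnorm_ge0 ?(ltW e0)// sqr_cnorm.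
  apply: (@le_lt_trans _ _ (\sum_(k < n) (2 * d) ^+ 2)).
    have d2 : 0 <= 2 * d by rewrite pmulr_rge0// ltW.
    apply: ler_sum => k _; rewrite ler_sqr ?nnegrE ?normc_ge0//.
    apply: (le_trans (normc_le _)); rewrite !mxE/=.
    have h1 := xy ord0 (lshift n k); have h2 := xy ord0 (rshift n k).
    rewrite /ball/= in h1 h2.
    by rewrite mulr_natl mulr2n lerD// ltW// distrC.
  rewrite sumr_const card_ord -[ltLHS]mulr_natl /d.
  have -> : e ^+ 2 = n.+1%:R ^+ 2 * (2 * (e / (2 * n.+1%:R))) ^+ 2 by field; rewrite gt_eqF.
  rewrite ltr_pM2r; last by rewrite exprn_gt0// mulr_gt0// divr_gt0// mulr_gt0.
  by rewrite -natrX ltr_nat expnS expn1 (leq_trans (ltnSn n))// leq_pmulr.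
pose B := [set x : 'rV[R]_(n + n) | forall k, `[- M, M]%classic (x ord0 k)].
pose K' := phi @^-1` K.
have cB : compact B.
  by apply: (@rV_compact _ _ (fun _ => `[- M, M]%classic)) => _; exact: segment_compact.
have K'B : K' `<=` B.
  move=> x /KM zM k.
  have xk j : normc (phi x ord0 j) <= M.
    apply: le_trans zM; rewrite -ler_sqr ?nnegrE ?normc_ge0 ?cnorm_ge0// sqr_cnorm.
    by rewrite (bigD1 j)//= lerDl sumr_ge0// => l _; exact: sqr_ge0.
  rewrite /= in_itv/= -ler_norml; have [j ->|j ->] := split_ordP k; apply: le_trans (xk j).
    by apply: le_trans (ler_normRe _); rewrite mxE.
  by apply: le_trans (ler_normIm _); rewrite mxE.
have K'cl : closed K'.
  move=> x xcl; apply: Kcl => e e0.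
  by have [y [K'y ye]] := xcl _ (phinear x e e0); exists (phi y).
have cK' := subclosed_compact K'cl cB K'B.
have [||x K'x xmax] := @compact_usc_argmax _ K' (g \o phi) cK'.
- by exists (psi z0); rewrite /K' /= psiK.
- move=> x t K'x /= /(gusc _ K'x)[e e0 He].
  by apply: filterS (phinear x e e0) => y ye K'y; exact: He.
exists (phi x) => // w Kw; rewrite -(psiK w); apply: xmax.
by rewrite /K' /= psiK.
Qed.

Lemma usc_argmax1 (K : set C) (g : C -> \bar R) :
  (exists M : R, forall z, K z -> normc z <= M) ->
  (forall z, (forall e : R, 0 < e -> exists2 w, K w & normc (w - z) < e) -> K z) ->
  K !=set0 ->
  (forall z (t : R), K z -> (g z < t%:E)%E ->
    exists2 e : R, 0 < e & forall w, K w -> normc (w - z) < e -> (g w < t%:E)%E) ->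
  exists2 z, K z & forall w, K w -> (g w <= g z)%E.
Proof.
move=> [M KM] Kcl [z0 Kz0] gusc.
have cn1 (z : 'rV[C]_1) : cnorm z = normc (z ord0 ord0).
  apply/eqP; rewrite -(@eqrXn2 _ 2)// ?cnorm_ge0 ?normc_ge0//.
  by rewrite sqr_cnorm big_ord1.
pose K' := [set z : 'rV[C]_1 | K (z ord0 ord0)].
have [||||z K'z zmax] := @usc_on_argmax 1 K' (fun z => g (z ord0 ord0)).
- by exists M => z K'z; rewrite cn1; exact: KM.
- move=> z H; apply: Kcl => e /H[w K'w]; rewrite cn1 !mxE => we.
  by exists (w ord0 ord0).
- by exists (const_mx z0); rewrite /K' /= mxE.
- move=> z K'z t /(gusc _ _ K'z)[e e0 He]; exists e => // w K'w.
  by rewrite cn1 !mxE; exact: He.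
exists (z ord0 ord0) => // w Kw.
by have := zmax (const_mx w); rewrite /K' /= mxE; apply.
Qed.

End UpperSemicontinuous.

(** * Comparison principle on complex lines *)

Section SubMean.
Context {R : realType} {n : nat}.
Local Notation C := R[i].
Local Notation V := 'rV[C]_n.
Local Open Scope complex_scope.
Local Notation normc := ComplexField.Normc.normc.
Local Notation mu := (@lebesgue_measure R).
Implicit Types (m t : R) (c d : C) (a b : V).

Definition expi t : C := cos t +i* sin t.

Definition trig2 m c d t : R := m + Re (c * expi t) + Re (d * (expi t * expi t)).

Lemma trig2E m c d t : trig2 m c d t = m + (Re c * cos t - Im c * sin t) +
  (Re d * (cos t * cos t - sin t * sin t) - Im d * (sin t * cos t + cos t * sin t)).
Proof. by rewrite /trig2; case: c => c1 c2; case: d => d1 d2 /=; ring. Qed.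

Lemma continuous_trig2 m c d : continuous (trig2 m c d).
Proof.
rewrite (funext (trig2E m c d)).
move=> t; apply: differentiable_continuous; apply/derivable1_diffP.
exact: ex_derive.
Qed.

Lemma integral_trig2 m c d :
  (\int[mu]_(t in `[0%R, (2 * pi)%R]) (trig2 m c d t)%:E = (2 * pi * m)%:E)%E.
Proof.
pose F (t : R) := m * t + Re c * sin t + Im c * cos t +
  Re d * (sin t * cos t) - Im d * (sin t * sin t).
have dF t : is_derive t 1 F (trig2 m c d t).
  rewrite /F trig2E; apply: is_derive_eq.
  by rewrite /GRing.scale/=; ring.
rewrite (@continuous_FTC2 _ _ F); first last.
- by move=> t _; rewrite derive1E; have [_ ->] := dF t.
- have cF : continuous F.
    by move=> t; apply: differentiable_continuous; apply/derivable1_diffP; have [] := dF t.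
  split; first by move=> t _; have [] := dF t.
    exact: cvg_at_right_filter (cF _).
  exact: cvg_at_left_filter (cF _).
- by apply: continuous_subspaceT; exact: continuous_trig2.
- by rewrite mulr_gt0// pi_gt0.
have p2 : 2 * pi = pi *+ 2 :> R by rewrite mulr_natl.
rewrite -EFinB /F p2 cos2pi sin2pi sin0 cos0; congr (_%:E); ring.
Qed.

Lemma cnorm_circ_pt a b s t : cnorm (circ_pt a b s - circ_pt a b t) =
  normc (expi s - expi t) * cnorm b.
Proof.
by rewrite -cnormZ /circ_pt opprD addrACA subrr add0r scalerBl.
Qed.

(** Lower semicontinuity of [- u] along the circle gives measurability of the integrand in the
    sub-mean value inequality. *)
Lemma usc_circ_lower_semicontinuous (O : set V) u a b : usc_on O u ->
  (forall t, O (circ_pt a b t)) -> lower_semicontinuous (fun t : R => (- u (circ_pt a b t))%E).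
Proof.
move=> uscu Oc t y.
rewrite lteNr -EFinN => /(uscu _ (Oc t))[e e0 He].
have cc : {for t, continuous (fun s => `|cos s - cos t| + `|sin s - sin t|)}.
  apply: cvgD; apply: cvg_norm; apply: cvgB; try exact: cvg_cst.
    exact: continuous_cos.
  exact: continuous_sin.
pose k := e / (cnorm b + 1).
have b1 : 0 < cnorm b + 1 by rewrite ltr_wpDl// cnorm_ge0.
have k0 : 0 < k by rewrite divr_gt0.
exists [set s | `|cos s - cos t| + `|sin s - sin t| < k].
  move/cvgrPdist_lt : cc => /(_ _ k0); apply: filterS => s.
  by rewrite !subrr normr0 addr0 sub0r normrN ger0_norm// addr_ge0.
move=> s /= sk; rewrite lteNr -EFinN; apply: He => //; rewrite cnorm_circ_pt.
apply: (@le_lt_trans _ _ (k * cnorm b)).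
  by rewrite ler_wpM2r ?cnorm_ge0// ltW//; exact: (le_lt_trans (normc_le (expi s - expi t)) sk).
by rewrite /k mulrAC ltr_pdivrMr// ltr_pM2l// ltrDl.
Qed.

(** The mean of [u] over the circle is at most the mean [m] of its majorant. If the integral of the
    nonnegative function [- u] is infinite, the sub-mean value inequality already forces
    [u a = -oo]; otherwise both sides are integrable. *)
Lemma sub_mean_trig2 (O : set V) u a b m c d : psh O u -> (forall z, O z -> (u z < 0)%E) ->
  O a -> (forall zeta : C, normc zeta <= 1 -> O (a + zeta *: b)) ->
  (forall t, (u (circ_pt a b t) <= (trig2 m c d t)%:E)%E) -> (u a <= m%:E)%E.
Proof.
move=> [_ uscu _ smv] u0 Oa Oab uP.
have Oc t : O (circ_pt a b t).
  apply: Oab; rewrite -(@ler_pXn2r _ 2)// ?nnegrE ?normc_ge0// sqr_normcE /=.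
  by rewrite cos2Dsin2 expr1n.
have pi2 : 0 < 2 * pi :> R by rewrite mulr_gt0// pi_gt0.
have := smv a b Oa; rewrite /=.
have Oab' (zeta : C) : `|zeta| <= 1 -> O (a + zeta *: b).
  by move=> z1; apply: Oab; rewrite -lecR.
move=> /(_ Oab'); set I := integral _ _ _ => uI.
pose f t := (- u (circ_pt a b t))%E.
have f0 t : (0 <= f t)%E by rewrite /f oppe_ge0 ltW// u0.
have mf := lower_semicontinuous_measurable (usc_circ_lower_semicontinuous uscu Oc).
have IE : I = (- \int[mu]_(t in `[0%R, (2 * pi)%R]) f t)%E.
  rewrite /I -integral_ge0N//; apply: eq_integral => t _.
  by rewrite /f oppeK.
have [->|fin] := eqVneq (u a) -oo%E; first by rewrite leNye.
have fI : (\int[mu]_(t in `[0%R, (2 * pi)%R]) f t < +oo)%E.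
  rewrite ltNge leye_eq; apply/negP => /eqP E.
  move: uI; rewrite IE E /= gt0_muleNy ?lte_fin ?invr_gt0// leeNy_eq.
  by move/eqP => E'; rewrite E' in fin.
have intf : mu.-integrable `[0%R, (2 * pi)%R] f.
  apply/integrableP; split; first exact: measurable_funTS.
  by under eq_integral do rewrite gee0_abs//.
have intu : mu.-integrable `[0%R, (2 * pi)%R] (fun t => u (circ_pt a b t)).
  rewrite (_ : (fun t => _) = \- f)%E; last by apply/funext => t; rewrite /f oppeK.
  exact: integrableN.
have intP : mu.-integrable `[0%R, (2 * pi)%R] (fun t => (trig2 m c d t)%:E).
  apply: continuous_compact_integrable; first exact: segment_compact.
  by apply: continuous_subspaceT; exact: continuous_trig2.
apply: (le_trans uI).
have IP : (I <= (2 * pi * m)%:E)%E.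
  rewrite -(integral_trig2 m c d); exact: le_integral.
apply: (@le_trans _ _ ((2 * pi)^-1%:E * (2 * pi * m)%:E)%E).
  by apply: lee_wpmul2l => //; rewrite lee_fin invr_ge0 ltW.
by rewrite -EFinM mulrA mulVf ?mul1r// gt_eqF.
Qed.

(* Strict sub-mean-value test: a second-order lower expansion of [W] at [a]
   whose quadratic part is harmonic up to [k |h|^2] with [k > 0]. *)
Definition strict_subjet (W : C -> R) (a : C) := exists (c d : C) (k e : R),
  [/\ 0 < k, 0 < e & forall h, normc h < e ->
    W a + Re (c * h) + Re (d * (h * h)) + k * normc h ^+ 2 <= W (a + h)].

Lemma jet2_strict_subjet (F : C -> C) (k : R) (a : C) : 0 < k -> jet2 (F : C^o -> C^o) a ->
  strict_subjet (fun z => Re (F z) + k * normc z ^+ 2) a.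
Proof.
move=> k0 [c [q [cq fq]]].
have k2 : 0 < k / 2 by rewrite divr_gt0.
have [e1 e10 He1] := (cvg_zeroP _ _).1 cq _ k2.
have /nbhs_zeroP [e2 e20 He2] := fq.
(* The cross term of [k |a + h|^2] joins the linear coefficient; half of [k] is spent on the
   remainder [(q h - q 0) h^2]. *)
exists (c + 2 * k%:C * a^*), (q 0), (k / 2), (Num.min e1 e2).
split; rewrite ?lt_min ?e10//.
move=> h; rewrite lt_min => /andP[/He1 h1 /He2 h2]; rewrite h2.
have h3 : - (k / 2) * normc h ^+ 2 <= Re ((q h - q 0) * (h * h)).
  have := ler_normRe ((q h - q 0) * (h * h)).
  rewrite !ComplexField.Normc.normcM ler_norml => /andP[+ _].
  apply: le_trans; rewrite mulNr lerN2 expr2 ler_wpM2r ?mulr_ge0 ?normc_ge0//.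
  exact: ltW.
have -> : normc (a + h) ^+ 2 = normc a ^+ 2 + 2 * Re (a^* * h) + normc h ^+ 2.
  by rewrite !sqr_normcE; case: (a) => x y; case: (h) => x' y' /=; ring.
have -> : F a + h * (c + h * q h) = F a + c * h + q 0 * (h * h) + (q h - q 0) * (h * h).
  by ring.
have ReD (z w : C) : Re (z + w) = Re z + Re w by case: z; case: w.
rewrite mulrDl !ReD.
have -> : Re (2 * k%:C * a^* * h) = 2 * k * Re (a^* * h).
  have -> : 2 * k%:C * a^* * h = (2 * k)%:C * (a^* * h).
    by rewrite rmorphM rmorphMn rmorph1; ring.
  by case: (a^* * h) => x y /=; ring.
lra.
Qed.

End SubMean.

Section SliceComparison.
Context {R : realType} {n : nat}.
Local Notation C := R[i].
Local Notation V := 'rV[C]_n.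
Local Open Scope complex_scope.
Local Notation normc := ComplexField.Normc.normc.

Lemma normc_expi (t : R) : normc (expi t) = 1.
Proof. by rewrite /= cos2Dsin2 sqrtr1. Qed.

(** At a maximum of [u + W] the lower expansion of [W] bounds [u] from above on the circle of radius
    [q] around [a], by a trigonometric polynomial of mean [r - k * q ^+ 2], which is below the value
    [r] of [u] at the centre. *)
Lemma psh_no_strict_max (O : set V) u (p v : V) (W : C -> R) (a : C) (s : R) :
  psh O u -> (forall z, O z -> (u z < 0)%E) -> u (p + a *: v)%R != -oo%E -> 0 < s ->
  (forall z, normc (z - a) <= s -> O (p + z *: v) /\
    (u (p + z *: v)%R + (W z)%:E <= u (p + a *: v)%R + (W a)%:E)%E) ->
  ~ strict_subjet W a.
Proof.
move=> pu u0 uaNy s0 amax [c [d [k [e [k0 e0 We]]]]].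
pose q := Num.min s (e / 2).
have q0 : 0 < q by rewrite lt_min s0 divr_gt0.
have qs : q <= s by rewrite ge_min lexx.
have qe : q < e by rewrite gt_min; apply/orP; right; lra.
have Oa : O (p + a *: v).
  by apply: (amax a _).1; rewrite subrr ComplexField.Normc.normc0 ltW.
have [r ur] : exists r : R, u (p + a *: v)%R = r%:E.
  by move: (u0 _ Oa) uaNy; case: (u _) => // r _ _; exists r.
have H := @sub_mean_trig2 R n O u (p + a *: v)%R (q%:C *: v) (r - k * q ^+ 2)
  (- (c * q%:C)) (- (d * (q%:C * q%:C))) pu u0 Oa.
suff : (r%:E <= (r - k * q ^+ 2)%:E)%E.
  by rewrite lee_fin; have := mulr_gt0 k0 (exprn_gt0 2 q0); lra.
rewrite -{1}ur; apply: H.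
  move=> zeta z1; rewrite scalerA -addrA -scalerDl; apply: (amax _ _).1.
  rewrite addrC addKr ComplexField.Normc.normcM normc_realc gtr0_norm//.
  by apply: le_trans qs; rewrite ler_piMl// ltW.
move=> t; pose h := q%:C * expi t.
have hq : normc h = q by rewrite ComplexField.Normc.normcM normc_expi normc_realc gtr0_norm// mulr1.
have -> : circ_pt (p + a *: v) (q%:C *: v) t = p + (a + h) *: v.
  by rewrite /circ_pt scalerA -addrA -scalerDl /h mulrC.
have ahs : normc (a + h - a) <= s by rewrite addrC addKr hq.
have [Oh] := amax _ ahs.
move: (u0 _ Oh) => /[swap]; rewrite ur.
case: (u _) => [x||]; rewrite ?leNye//.
rewrite -!EFinD !lee_fin => xa _.
have := We h; rewrite hq => /(_ qe) Wh.
rewrite /trig2.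
have ReN (z : C) : Re (- z) = - Re z by case: z.
have -> : - (c * q%:C) * expi t = - (c * h) by rewrite /h; ring.
have -> : - (d * (q%:C * q%:C)) * (expi t * expi t) = - (d * (h * h)) by rewrite /h; ring.
rewrite !ReN; lra.
Qed.

(** In place of a boundary of [T], each point of [T] either satisfies the bound or is interior. A
    violation at [z1] survives the addition of a small multiple of [|z|^2]; the maximum of the sum
    is then interior, which [psh_no_strict_max] forbids. *)
Lemma slice_comparison (O : set V) u (p v : V) (T : set C) (F : C -> C) (eps : R) :
  psh O u -> (forall z, O z -> (u z < 0)%E) -> cnorm v = 1 ->
  (exists M : R, forall z, T z -> normc z <= M) ->
  (forall z, (forall e : R, 0 < e -> exists2 w, T w & normc (w - z) < e) -> T z) ->
  (forall z, T z -> O (p + z *: v) /\ jet2 (F : C^o -> C^o) z) ->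
  (forall z, T z -> (u (p + z *: v)%R + (Re (F z))%:E <= eps%:E)%E \/
     exists2 e : R, 0 < e & forall w, normc (w - z) < e -> T w) ->
  forall z, T z -> (u (p + z *: v)%R + (Re (F z))%:E <= eps%:E)%E.
Proof.
move=> pu u0 v1 [M TM] Tcl TO Tbd z1 Tz1.
have [_ uscu _ _] := pu.
rewrite leNgt; apply/negP => zeps.
have [Oz1 _] := TO _ Tz1.
have [r ur] : exists r : R, u (p + z1 *: v)%R = r%:E.
  by move: (u0 _ Oz1) zeps; case: (u _) => // x _ _; exists x.
move: zeps; rewrite ur -EFinD lte_fin => zeps.
have M0 : 0 <= M := le_trans (normc_ge0 _) (TM _ Tz1).
pose g := r + Re (F z1) - eps.
have g0 : 0 < g by rewrite subr_gt0.
(* [g] is the excess at [z1]. On [T] the perturbation is at most [k * M ^+ 2 < g], so a point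
   satisfying the bound cannot carry the maximum. *)
pose k := g / (2 * (M ^+ 2 + 1)).
have M1 : 0 < M ^+ 2 + 1 by rewrite ltr_wpDl ?sqr_ge0.
have k0 : 0 < k by rewrite divr_gt0// mulr_gt0.
have kM : k * M ^+ 2 < g.
  rewrite /k mulrAC ltr_pdivrMr ?mulr_gt0// ltr_pM2l//.
  by have := sqr_ge0 M; lra.
pose W (z : C) := Re (F z) + k * normc z ^+ 2.
have Wc z : T z -> forall e : R, 0 < e ->
    exists2 d : R, 0 < d & forall h, normc h < d -> W (z + h) < W z + e.
  move=> Tz e e0; have [_ /jet2_continuous/cvg_zeroP Fc] := TO _ Tz.
  have e2 : 0 < e / 2 by rewrite divr_gt0.
  have [d d0 Hd] := Fc _ e2.
  pose N := k * (2 * normc z + 1) + 1.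
  have N0 : 0 < N by rewrite ltr_wpDl// mulr_ge0 ?(ltW k0)// addr_ge0// mulr_ge0// normc_ge0.
  exists (Num.min d (Num.min 1 (e / 2 / N))).
    by rewrite !lt_min d0 ltr01 divr_gt0.
  move=> h; rewrite !lt_min => /and3P[/Hd hd h1 hN].
  have hN' : normc h * N < e / 2 by rewrite -ltr_pdivlMr.
  have : Re (F (z + h)) < Re (F z) + e / 2.
    have := ler_normRe (F (z + h) - F z).
    have -> : Re (F (z + h) - F z) = Re (F (z + h)) - Re (F z).
      by case: (F (z + h)) => x y; case: (F z).
    by rewrite ler_norml => /andP[_]; lra.
  have : normc (z + h) ^+ 2 <= normc z ^+ 2 + (2 * normc z + 1) * normc h.
    have h0 := normc_ge0 h; have z0 := normc_ge0 z.
    apply: (@le_trans _ _ ((normc z + normc h) ^+ 2)).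
      by rewrite ler_sqr ?nnegrE ?addr_ge0 ?normc_ge0// le_normcD.
    have : normc h * normc h <= 1 * normc h by rewrite ler_wpM2r// ltW.
    by rewrite -[X in X ^+ 2]/(normc z + normc h) expr2; lra.
  move=> /(ler_wpM2l (ltW k0)) h2 h3.
  have h4 : k * ((2 * normc z + 1) * normc h) <= normc h * N.
    by rewrite /N; have := normc_ge0 h; lra.
  by rewrite /W; lra.
pose G z := (u (p + z *: v)%R + (W z)%:E)%E.
have [||||a Ta amax] := @usc_argmax1 R T G.
- by exists M.
- exact: Tcl.
- by exists z1.
- move=> z t Tz Gt; have [Oz _] := TO _ Tz.
  have [x [ux xt]] : exists x : R, (u (p + z *: v)%R < x%:E)%E /\ 0 < t - x - W z.
    move: Gt (u0 _ Oz); rewrite /G; case: (u _) => [y||]//.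
      rewrite -EFinD lte_fin => yt _; exists ((y + (t - W z)) / 2).
      by rewrite lte_fin; split; lra.
    by move=> _ _; exists (t - W z - 1); rewrite ltNyr; split => //; lra.
  have [e e0 He] := uscu _ Oz _ ux.
  have [d d0 Hd] := Wc _ Tz _ xt.
  exists (Num.min d e); first by rewrite lt_min d0.
  move=> w Tw; rewrite lt_min => /andP[wd we].
  have [Ow _] := TO _ Tw.
  have := He _ Ow; rewrite opprD addrACA subrr add0r -scalerBl cnormZ v1 mulr1 => /(_ we).
  have := Hd _ wd; rewrite addrCA subrr addr0.
  rewrite /G; move: (u0 _ Ow); case: (u _) => [y||]//; last by move=> *; exact: ltNyr.
  by rewrite -EFinD !lte_fin => _ ? ?; lra.
have Ga : ((r + W z1)%:E <= G a)%E by rewrite EFinD -ur; exact: amax.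
have [Oa ja] := TO _ Ta.
have uaNy : u (p + a *: v)%R != -oo%E.
  by apply/eqP => E; move: Ga; rewrite /G E.
have [abd|[e e0 He]] := Tbd _ Ta.
  have : (G a <= (eps + k * M ^+ 2)%:E)%E.
    rewrite /G /W EFinD addeA EFinD leeD// lee_fin ler_pM2l//.
    by rewrite ler_sqr ?nnegrE ?normc_ge0// TM.
  move=> /(le_trans Ga); rewrite lee_fin leNgt => /negP; apply.
  rewrite /W; have : 0 <= k * normc z1 ^+ 2 by rewrite mulr_ge0 ?sqr_ge0// ltW.
  by move: kM; rewrite /g; lra.
apply: (@psh_no_strict_max O u p v W a (e / 2) pu u0 uaNy _ _ (jet2_strict_subjet k0 ja)).
  by rewrite divr_gt0.
move=> z ze; have Tz : T z by apply: He; apply: (le_lt_trans ze); lra.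
by split; [have [] := TO _ Tz|exact: amax].
Qed.

End SliceComparison.

(** * The barrier *)

Section Barrier.
Context {R : realType}.
Local Notation C := R[i].
Local Open Scope complex_scope.
Local Notation normc := ComplexField.Normc.normc.
Variables (beta B : R).
Hypotheses (beta0 : 0 < beta) (B0 : 0 < B).

(** For [beta = 1/alpha - 1] and [B = C^(1/alpha)] this is the constant [A] of the theorem. *)
Definition barrierA : R := pi * B / (2 * beta).
(** Chosen so that [A / (B s) (1 - beta s^2 / 2) + K B s = pi / (2 beta s) (1 + (beta^2 + 2) s^2)],
    the lower bound for the amplitude of [Im (phase z)] at a boundary point of slope [s]. *)
Definition barrierK : R := pi * (beta ^+ 2 + 2 + beta / 2) / (2 * beta * B).

(* The phase [A z^-beta - K z^beta]: its first term alone has imaginary part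
   of modulus slightly below [pi / 2] on the boundary of the cusp, and the second one corrects this. *)
Definition phase (z : C) : C :=
  barrierA%:C * cexp ((- beta)%:C * clog z) + (- barrierK)%:C * cexp (beta%:C * clog z).

(* [slope x = y / x] at the boundary point [x + iy] of the cusp. *)
Definition slope (x : R) : R := expR (beta * ln x) / B.

Local Notation A := barrierA.
Local Notation K := barrierK.

Lemma barrierA_gt0 : 0 < A.
Proof. by rewrite divr_gt0// ?mulr_gt0// pi_gt0. Qed.

Lemma barrierK_ge0 : 0 <= K.
Proof.
apply: divr_ge0; last by rewrite ltW// !mulr_gt0.
rewrite mulr_ge0// ?pi_ge0// addr_ge0//; last by rewrite divr_ge0// ltW.
by rewrite addr_ge0// sqr_ge0.
Qed.

Lemma slope_gt0 x : 0 < slope x.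
Proof. by rewrite divr_gt0// expR_gt0. Qed.

Lemma ler_slope x x' : 0 < x -> x <= x' -> slope x <= slope x'.
Proof.
move=> x0 xx'; rewrite ler_pM2r ?invr_gt0// ler_expR ler_pM2l// ler_ln ?posrE//.
exact: lt_le_trans xx'.
Qed.

Lemma jet2_phase z : 0 < Re z -> jet2 (phase : C^o -> C^o) z.
Proof.
move=> z0; have jl := jet2_clog z0.
by apply: jet2D; apply: jet2_scale; apply: (jet2_comp (f := fun z => _ * clog z));
  [exact: jet2_scale|exact: jet2_cexp|exact: jet2_scale|exact: jet2_cexp].
Qed.

Lemma jet2_barrier (k : R) z : 0 < Re z ->
  jet2 ((fun z => k%:C * cexp (- phase z)) : C^o -> C^o) z.
Proof.
move=> z0; apply: jet2_scale; apply: (jet2_comp (f := fun z => - phase z)); last exact: jet2_cexp.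
rewrite (_ : (fun z => - phase z) = (fun z => -1 * phase z)).
  by apply: jet2_scale; exact: jet2_phase.
by apply/funext => w; rewrite mulN1r.
Qed.

Lemma Re_phase z : Re (phase z) = cos (beta * atan (Im z / Re z)) *
  (A * expR (- (beta * ln (normc z))) - K * expR (beta * ln (normc z))).
Proof.
rewrite /phase /cexp /clog /= !mul0r !subr0 !addr0 !mulNr ?cosN ?sinN; ring.
Qed.

Lemma Im_phase z : Im (phase z) = - (sin (beta * atan (Im z / Re z)) *
  (A * expR (- (beta * ln (normc z))) + K * expR (beta * ln (normc z)))).
Proof.
rewrite /phase /cexp /clog /= !mul0r !subr0 !addr0 !mulNr ?cosN ?sinN; ring.
Qed.

Lemma Re_barrier (k : R) z :
  Re (k%:C * cexp (- phase z)) = k * (expR (- Re (phase z)) * cos (Im (phase z))).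
Proof. by rewrite /cexp; case: (phase z) => a b /=; rewrite cosN mul0r subr0. Qed.

(** With [s] the slope and [Q = beta^2 + 1], the sine factor is at least [beta s (1 - Q s^2)] and
    the amplitude at least [pi / (2 beta s) (1 + (Q + 1) s^2)]. Their product is
    [pi / 2 (1 + s^2 (1 - Q (Q + 1) s^2))], and the smallness hypothesis makes the inner bracket
    positive. *)
Lemma Im_phase_boundary z : 0 < Re z -> `|Im z| = Re z * slope (Re z) ->
  (beta ^+ 2 + 1) * (beta ^+ 2 + 2) * slope (Re z) ^+ 2 < 1 ->
  pi / 2 < `|Im (phase z)|.
Proof.
set x := Re z; set s := slope x; set Q := beta ^+ 2 + 1 => x0 yE Qs.
have s0 : 0 < s := slope_gt0 x.
have s2 : 0 < s ^+ 2 by rewrite exprn_gt0.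
have b2 : 0 < beta ^+ 2 by rewrite exprn_gt0.
have p0 : 0 < pi :> R := pi_gt0 R.
have Q1 : 1 < Q by rewrite /Q; lra.
have Qs0 : 0 < Q * s ^+ 2 by apply: mulr_gt0 => //; lra.
have QQs : Q * s ^+ 2 <= 1 / 2.
  have : 2 * (Q * s ^+ 2) <= (Q + 1) * (Q * s ^+ 2) by rewrite ler_wpM2r ?(ltW Qs0)//; lra.
  by move: Qs; rewrite (_ : beta ^+ 2 + 2 = Q + 1); [lra|rewrite /Q; ring].
pose l := ln (normc z).
have nz : normc z ^+ 2 = x ^+ 2 * (1 + s ^+ 2).
  rewrite sqr_normcE -/x -(real_normK (num_real (Im z))) yE -/s; ring.
have nz0 : 0 < normc z := normc_gt0 x0.
have p1 : 0 < 1 + s ^+ 2 by rewrite addr_gt0.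
have lE : 2 * l = 2 * ln x + ln (1 + s ^+ 2).
  have := congr1 (@ln R) nz.
  rewrite lnXn// (@lnM _ (x ^+ 2)) ?posrE ?(exprn_gt0 2 x0) ?p1// lnXn//.
  by rewrite -[_ *+ 2]mulr_natl -[ln x *+ 2]mulr_natl.
have l1 : ln x <= l.
  by have : 0 <= ln (1 + s ^+ 2); [rewrite ln_ge0// lerDl ltW|lra].
have l2 : l <= ln x + s ^+ 2 / 2.
  by have := @le_ln1Dx R (s ^+ 2) (lt_trans (ltrN10 R) s2); lra.
have xs : expR (beta * ln x) = B * s by rewrite /s /slope mulrCA mulfV ?mulr1// gt_eqF.
clearbody s.
have E1 : (B * s)^-1 * (1 - beta * s ^+ 2 / 2) <= expR (- (beta * l)).
  have h : expR (- (beta * ln x) + - (beta * (s ^+ 2 / 2))) <= expR (- (beta * l)).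
    by rewrite ler_expR -opprD lerN2 -mulrDr ler_pM2l.
  apply: le_trans h; rewrite expRD expRN xs.
  rewrite ler_pM2l ?invr_gt0 ?mulr_gt0//.
  by apply: le_trans (expR_ge1Dx _); rewrite mulrA.
have E2 : B * s <= expR (beta * l) by rewrite -xs ler_expR ler_pM2l.
have E3 : pi / (2 * beta * s) * (1 + (Q + 1) * s ^+ 2) <=
    A * expR (- (beta * l)) + K * expR (beta * l).
  have h1 : A * ((B * s)^-1 * (1 - beta * s ^+ 2 / 2)) <= A * expR (- (beta * l)).
    by apply: ler_wpM2l E1; exact: ltW barrierA_gt0.
  have h2 : K * (B * s) <= K * expR (beta * l) by apply: ler_wpM2l E2; exact: barrierK_ge0.
  apply: (le_trans _ (lerD h1 h2)).
  rewrite le_eqVlt; apply/orP; left; apply/eqP; rewrite /A /K /Q; field.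
  by rewrite !gt_eqF.
set E := A * _ + K * _ in E3.
have E0 : 0 < E.
  apply: lt_le_trans E3; rewrite mulr_gt0 ?divr_gt0 ?mulr_gt0//.
  by rewrite addr_gt0// mulr_gt0//; lra.
have sx : x * s / x = s by rewrite mulrAC mulfV ?mul1r// gt_eqF.
have -> : `|Im (phase z)| = `|sin (beta * atan s)| * E.
  rewrite Im_phase normrN normrM -/l -/E (gtr0_norm E0); congr (_ * _).
  have [y0|y0] := leP 0 (Im z).
    by move: yE; rewrite (ger0_norm y0) => ->; rewrite -/x sx.
  move: yE; rewrite (ltr0_norm y0) => /eqP; rewrite eqr_oppLR => /eqP ->.
  by rewrite -/x mulNr sx atanN mulrN sinN normrN.
set a := beta * atan s.
have /andP[a1 a2] : beta * (s / (1 + s ^+ 2)) <= a <= beta * s.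
  by have /andP[? ?] := atan_bounds (ltW s0); rewrite !ler_pM2l//; apply/andP.
have a0 : 0 < a by apply: lt_le_trans a1; rewrite mulr_gt0// divr_gt0// addr_gt0.
have bs1 : beta ^+ 2 * s ^+ 2 <= 1 by move: QQs; rewrite /Q mulrDl; lra.
have bs0 : 0 < beta * s by exact: mulr_gt0.
(* Two losses, [sin a >= a - a^3] and [atan s >= s / (1 + s^2) >= s (1 - s^2)], together cost at
   most the factor [1 - Q s^2]. *)
have S1 : beta * s * (1 - Q * s ^+ 2) <= sin a.
  apply: le_trans (sin_cube (ltW a0)).
  have aa : a ^+ 2 <= beta ^+ 2 * s ^+ 2.
    by rewrite -exprMn ler_sqr ?nnegrE ?(ltW a0) ?(ltW bs0).
  have h1 : a * (1 - beta ^+ 2 * s ^+ 2) <= a - a ^+ 3.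
    have -> : a - a ^+ 3 = a * (1 - a ^+ 2) by ring.
    by rewrite ler_pM2l// lerD2l lerN2.
  apply: le_trans h1.
  have h2 : beta * s * (1 - s ^+ 2) <= a.
    apply: le_trans a1; rewrite -mulrA ler_pM2l// ler_pM2l//.
    rewrite -[leRHS]mul1r ler_pdivlMr ?addr_gt0//.
    by have := mulr_gt0 s2 s2; lra.
  apply: (@le_trans _ _ (beta * s * (1 - s ^+ 2) * (1 - beta ^+ 2 * s ^+ 2))).
    rewrite -[leRHS]mulrA ler_pM2l//.
    by have := mulr_gt0 b2 (mulr_gt0 s2 s2); rewrite /Q; lra.
  by rewrite ler_wpM2r// subr_ge0.
have S0 : 0 < beta * s * (1 - Q * s ^+ 2) by apply: mulr_gt0 => //; lra.
rewrite gtr0_norm; last exact: lt_le_trans S1.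
have P0 : 0 <= pi / (2 * beta * s) * (1 + (Q + 1) * s ^+ 2).
  by rewrite mulr_ge0 ?divr_ge0 ?ltW ?mulr_gt0// addr_gt0// mulr_gt0//; lra.
apply: lt_le_trans (ler_pM (ltW S0) P0 S1 E3).
have -> : beta * s * (1 - Q * s ^+ 2) * (pi / (2 * beta * s) * (1 + (Q + 1) * s ^+ 2)) =
    pi / 2 * (1 + s ^+ 2 * (1 - Q * (Q + 1) * s ^+ 2)).
  by field; rewrite !gt_eqF.
rewrite ltr_pMr ?divr_gt0// ltrDl mulr_gt0// subr_gt0.
by rewrite (_ : Q + 1 = beta ^+ 2 + 2)// /Q; ring.
Qed.

(** Since [|beta * arg z| <= 1] the cosine is at least [1/2], and [|z| <= 2 Re z <= 1] controls both
    powers. The bound makes the barrier vanish at the vertex and gives [Re (phase z) >= - K] on the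
    cap. *)
Lemma Re_phase_ge z : 0 < Re z -> Re z <= 1 / 2 -> `|Im z| <= Re z * slope (Re z) ->
  slope (Re z) <= 1 -> beta * slope (Re z) <= 1 ->
  A / 2 * expR (- (beta * ln (2 * Re z))) - K <= Re (phase z).
Proof.
set x := Re z; set s := slope x => x0 x2 ys s1 bs.
have s0 : 0 < s := slope_gt0 x.
rewrite Re_phase -/x; set t := Im z / x; set l := ln (normc z).
have ts : `|t| <= s.
  by rewrite normrM normfV (gtr0_norm x0) ler_pdivrMr// mulrC.
have bt : (beta * atan t) ^+ 2 <= 1.
  have at1 : `|atan t| <= s.
    have [t0|t0] := leP 0 t.
      have /andP[h1 h2] := atan_bounds t0.
      rewrite ger0_norm; first by apply: le_trans h2 _; apply: le_trans ts; rewrite ger0_norm.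
      by apply: le_trans h1; rewrite divr_ge0// addr_ge0// sqr_ge0.
    have t0' : 0 <= - t by rewrite oppr_ge0 ltW.
    have /andP[h1 h2] := atan_bounds t0'.
    rewrite -normrN -atanN ger0_norm.
      by apply: le_trans h2 _; apply: le_trans ts; rewrite ltr0_norm.
    by apply: le_trans h1; rewrite divr_ge0// addr_ge0// sqr_ge0.
  rewrite -(real_normK (num_real _)) expr_le1// normrM (gtr0_norm beta0).
  by apply: le_trans bs; rewrite ler_pM2l.
have c1 : 1 / 2 <= cos (beta * atan t) by apply: le_trans (cos_ge_sqr _); lra.
have c2 := cos_le1 (beta * atan t).
have nz2 : normc z <= 2 * x.
  apply: (le_trans (normc_le z)); rewrite -/x (gtr0_norm x0).
  by have : x * s <= x * 1; [rewrite ler_pM2l|lra].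
have nz0 : 0 < normc z := normc_gt0 x0.
have x20 : 0 < 2 * x by rewrite mulr_gt0.
have l1 : l <= ln (2 * x) by rewrite ler_ln ?posrE.
have l0 : l <= 0 by apply: (le_trans l1); rewrite ln_le0//; lra.
have e1 : expR (- (beta * ln (2 * x))) <= expR (- (beta * l)).
  by rewrite ler_expR lerN2 ler_pM2l.
have e2 : expR (beta * l) <= 1 by rewrite expR_le1 pmulr_rle0.
rewrite mulrBr; apply: lerB.
  have -> : A / 2 * expR (- (beta * ln (2 * x))) = 1 / 2 * (A * expR (- (beta * ln (2 * x)))) by field.
  have A0 : 0 <= A := ltW barrierA_gt0.
  apply: ler_pM; [lra|by apply: mulr_ge0; rewrite ?expR_ge0|exact: c1|].
  by apply: (ler_wpM2l A0); exact: e1.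
have K0 := barrierK_ge0; have e0 := expR_ge0 (beta * l).
apply: (@le_trans _ _ (1 * (K * 1))); last by rewrite mul1r mulr1.
apply: ler_pM; [lra|by rewrite mulr_ge0|exact: c2|by rewrite ler_wpM2l].
Qed.

Lemma Re_barrier_le (k b : R) z : 0 <= k -> b <= Re (phase z) ->
  Re (k%:C * cexp (- phase z)) <= k * expR (- b).
Proof.
move=> k0 bz; rewrite Re_barrier ler_wpM2l//.
apply: (@le_trans _ _ (expR (- Re (phase z)) * 1)).
  by rewrite ler_wpM2l ?expR_ge0// cos_le1.
by rewrite mulr1 ler_expR lerN2.
Qed.

(** On the axis the phase is real, and its term [- K t^beta] only enlarges the barrier. *)
Lemma Re_barrier_real (k t : R) : 0 <= k -> 0 < t ->
  k * expR (- (A * expR (- (beta * ln t)))) <= Re (k%:C * cexp (- phase t%:C)).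
Proof.
move=> k0 t0; rewrite Re_barrier Re_phase Im_phase normc_realc gtr0_norm//=.
rewrite mul0r atan0 mulr0 sin0 mul0r oppr0 cos0 mulr1 mul1r ler_wpM2l//.
by rewrite ler_expR lerN2 lerBlDr lerDl mulr_ge0 ?expR_ge0 ?barrierK_ge0.
Qed.

End Barrier.

(** * Cusps *)

Section CuspGeometry.
Context {R : realType} {n : nat}.
Local Notation C := R[i].
Local Notation V := 'rV[C]_n.
Local Open Scope complex_scope.
Local Notation normc := ComplexField.Normc.normc.
Implicit Types (p v e : V).

(** [x * slope x] is the half-width of the planar cusp at abscissa [x], the solution [y] of
    [C0 * y^alpha = x]. *)
Lemma slope_cusp (C0 alpha x : R) : 0 < C0 -> 0 < alpha -> 0 < x ->
  C0 * (x * slope (alpha^-1 - 1) (C0 `^ alpha^-1) x) `^ alpha = x.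
Proof.
move=> C00 a0 x0; rewrite /slope.
have -> : x * (expR ((alpha^-1 - 1) * ln x) / C0 `^ alpha^-1) = (x / C0) `^ alpha^-1.
  have -> : (x / C0) `^ alpha^-1 = x `^ alpha^-1 / C0 `^ alpha^-1.
    apply: (canRL (mulfK _)); first by rewrite gt_eqF// powR_gt0.
    by rewrite -powRM ?divr_ge0 ?ltW// divfK// gt_eqF.
  rewrite mulrA; congr (_ / _).
  by rewrite /powR gt_eqF// -[X in X * _](@lnK _ x) ?posrE// -expRD; congr expR; ring.
rewrite -powRrM mulVf ?gt_eqF// powRr1 ?divr_ge0 ?ltW//.
by rewrite mulrC divfK// gt_eqF.
Qed.

Lemma reherm_perturb (z : C) v e : cnorm v = 1 -> Re z - cnorm e <= reherm (z *: v + e) v.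
Proof.
move=> v1; rewrite rehermDl reherm_scale// lerD2l.
by have := norm_reherm_le e v; rewrite v1 mulr1 ler_norml => /andP[].
Qed.

Lemma cnorm_proj_perturb (z : C) v e : cnorm v = 1 ->
  cnorm (proj_hyp v (z *: v + e)) <= `|Im z| + 2 * cnorm e.
Proof.
move=> v1; rewrite /proj_hyp rehermDl reherm_scale//.
have -> : z *: v + e - (Re z + reherm e v)%:C *: v =
    (0 +i* Im z) *: v + (e - (reherm e v)%:C *: v).
  have -> : (Re z + reherm e v)%:C = (Re z)%:C + (reherm e v)%:C by rewrite rmorphD.
  have {1}-> : z = (Re z)%:C + (0 +i* Im z).
    by case: z => a b; apply/eqP; rewrite eq_complex/= addr0 add0r !eqxx.
  rewrite !scalerDl; set a := (Re z)%:C *: v.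
  by rewrite opprD addrACA [a + _ - a]addrAC subrr add0r.
apply: (le_trans (ler_cnormD _ _)); rewrite cnormZ v1 mulr1.
apply: lerD; first by rewrite /= expr0n add0r sqrtr_sqr.
apply: (le_trans (ler_cnormD _ _)); rewrite cnormN cnormZ v1 mulr1 normc_realc.
by have := norm_reherm_le e v; rewrite v1 mulr1; lra.
Qed.

(** An error [e] changes the real part by at most [|e|] and the projection by at most [2 |e|]. The
    case [e = 0] puts the slice into [Omega]; small [e] gives the caps a uniform depth. *)
Lemma cusp_perturb (C0 alpha : R) (z : C) p v e : 0 < C0 -> 0 < alpha -> cnorm v = 1 ->
  C0 * (`|Im z| + 2 * cnorm e) `^ alpha < Re z - cnorm e ->
  cusp p v C0 alpha (p + z *: v + e).
Proof.
move=> C00 a0 v1 h; rewrite /cusp /=.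
have -> : p + z *: v + e - p = z *: v + e by rewrite -(addrA p) [p + _]addrC addrK.
apply: lt_le_trans (reherm_perturb _ _ v1); apply: le_lt_trans h.
rewrite ler_pM2l//; apply: ge0_ler_powR.
- exact: ltW.
- by rewrite nnegrE cnorm_ge0.
- by rewrite nnegrE addr_ge0// mulr_ge0// cnorm_ge0.
exact: cnorm_proj_perturb.
Qed.

Lemma cball_perturb (r : R) (z : C) p v e : cnorm v = 1 -> normc z + cnorm e < r ->
  cball p r (p + z *: v + e).
Proof.
move=> v1 h; rewrite /cball /= -(addrA p) [p + _]addrC addrK.
by apply: le_lt_trans h; apply: (le_trans (ler_cnormD _ _)); rewrite cnormZ v1 mulr1.
Qed.

(** Depth is expressed through balls, so that [cusp_perturb] and [cball_perturb] prove membership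
    directly. *)
Definition core (O : set V) (eta : R) : set V := [set z | cball z eta `<=` O].

Lemma core_closed (O : set V) eta : cclosed (core O eta).
Proof.
move=> z zcl w /= wz.
have [|x Kx xz] := zcl (eta - cnorm (w - z)); first by rewrite subr_gt0.
apply: Kx; rewrite /cball /=.
have -> : w - x = (w - z) + (z - x) by rewrite addrA subrK.
apply: (le_lt_trans (ler_cnormD _ _)).
by rewrite -(cnormN (z - x)) opprB -ltrBrDl.
Qed.

(** The maximum is attained, hence strictly negative; if [K] is empty or the maximum is [-oo], any
    constant serves. *)
Lemma usc_lt0_bound (K : set V) u : cbounded K -> cclosed K -> usc_on K u ->
  (forall z, K z -> (u z < 0)%E) ->
  exists2 c : R, 0 < c & forall z, K z -> (u z <= (- c)%:E)%E.
Proof.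
move=> Kb Kc uscu u0; have [[z0 Kz0]|K0] := pselect (K !=set0); last first.
  by exists 1 => // z Kz; exfalso; apply: K0; exists z.
have [z Kz zmax] := usc_on_argmax Kb Kc (ex_intro _ z0 Kz0) uscu.
suff [c c0 zc] : exists2 c : R, 0 < c & (u z <= (- c)%:E)%E.
  by exists c => // w Kw; exact: le_trans (zmax _ Kw) zc.
move: (u0 _ Kz); case: (u z) => [x||]//.
  by rewrite lte_fin => x0; exists (- x); rewrite ?oppr_gt0// opprK.
by move=> _; exists 1; rewrite ?leNye.
Qed.

Lemma psh_core_bound (O : set V) u eta : 0 < eta -> cbounded O -> psh O u ->
  (forall z, O z -> (u z < 0)%E) ->
  exists2 c : R, 0 < c & forall z, core O eta z -> (u z <= (- c)%:E)%E.
Proof.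
move=> eta0 [M OM] [_ uscu _ _] u0.
have coreO : core O eta `<=` O.
  by move=> z; apply; rewrite /cball /= subrr cnorm0.
apply: usc_lt0_bound.
- by exists M => z /coreO; exact: OM.
- exact: core_closed.
- move=> z /coreO Oz t /(uscu _ Oz)[e e0 He]; exists e => // w /coreO Ow; exact: He.
- by move=> z /coreO; exact: u0.
Qed.

(** A ball around [z] inside [O] misses the boundary. The point [p] also keeps the set under [inf]
    nonempty, which excludes the default value [0]. *)
Lemma dist_bd_gt0_le (O : set V) (z p : V) : copen O -> O z -> cboundary O p ->
  0 < dist_bd O z <= cnorm (z - p).
Proof.
move=> oO Oz Op; have [e e0 He] := oO _ Oz.
have lb : lbound [set d | exists2 q, cboundary O q & d = cnorm (z - q)] e.
  move=> _ [q [nOq _] ->]; rewrite leNgt; apply/negP => h.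
  by apply: nOq; apply: He; rewrite /cball /= -cnormN opprB.
rewrite (lt_le_trans e0)/=.
  by apply: ge_inf; [exists e|exists p].
by apply: lb_le_inf => //; exists (cnorm (z - p)), p.
Qed.

End CuspGeometry.

(** * The estimate on the slice through the axis of one cusp *)

Section SliceEstimate.
Context {R : realType}.
Local Notation C := R[i].
Local Open Scope complex_scope.
Local Notation normc := ComplexField.Normc.normc.
Variables (beta B : R).
Hypotheses (beta0 : 0 < beta) (B0 : 0 < B).

Local Notation A := (barrierA beta B).
Local Notation K := (barrierK beta B).
Local Notation phase := (phase beta B).
Local Notation slope := (slope beta B).

(** One threshold serves every smallness condition: with [N = beta^2 + 2] and [s N <= 1], the first
    product is [(N s - s) (s N)], and [beta <= N]. *)
Lemma slope_small x : slope x <= (beta ^+ 2 + 2)^-1 ->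
  [/\ (beta ^+ 2 + 1) * (beta ^+ 2 + 2) * slope x ^+ 2 < 1, slope x <= 1 &
     beta * slope x <= 1].
Proof.
have s0 := slope_gt0 beta B0 x; move: (slope x) s0 => s s0.
have b2 : 0 <= beta ^+ 2 := sqr_ge0 _.
have N0 : 0 < beta ^+ 2 + 2 by rewrite ltr_wpDl.
rewrite -[_^-1]mul1r ler_pdivlMr// => sN.
have s1 : s <= 1 by have := mulr_ge0 (ltW s0) b2; lra.
split => //.
- have -> : (beta ^+ 2 + 1) * (beta ^+ 2 + 2) * s ^+ 2 =
      ((beta ^+ 2 + 2) * s - s) * (s * (beta ^+ 2 + 2)) by ring.
  set t := s * _ in sN *; have t0 : 0 < t by rewrite mulr_gt0.
  have -> : (beta ^+ 2 + 2) * s - s = t - s by rewrite /t; ring.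
  have : (t - s) * t <= (t - s) * 1.
    by rewrite ler_wpM2l// /t subr_ge0 ler_pMr//; lra.
  lra.
- have : beta <= beta ^+ 2 + 2 by have := sqr_ge0 (beta - 1); rewrite sqrrB1 -mulr_natl; lra.
  rewrite -(ler_pM2r s0); lra.
Qed.

Lemma cvg_phase z : 0 < Re z ->
  (fun h => `|Im (phase (z + h))|) @ nbhs_zero --> `|Im (phase z)|.
Proof.
move=> z0; apply: cvg_norm; apply: (@cvg_Im _ (fun h => phase (z + h))).
by apply: jet2_continuous; apply: jet2_phase.
Qed.

(** At the two corners of the cap [|Im (phase z)|] exceeds [pi / 2], and by continuity also near
    them, so the admissible part of the cap stays below a height [y < x * slope x]. This gap depends
    on [x], [beta] and [B] alone, so it is common to all cusps. *)
Lemma phase_cap (x : R) : 0 < x -> slope x <= (beta ^+ 2 + 2)^-1 ->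
  exists y : R, 0 <= y < x * slope x /\
    forall z, Re z = x -> `|Im z| <= x * slope x -> `|Im (phase z)| <= pi / 2 ->
      `|Im z| <= y.
Proof.
move=> x0 /slope_small[sx _ _]; set Y := x * slope x.
have Y0 : 0 < Y by rewrite mulr_gt0// slope_gt0.
have near_bd (b : R) : `|b| = Y -> exists2 d : R, 0 < d &
    forall z, Re z = x -> `|Im z - b| < d -> pi / 2 < `|Im (phase z)|.
  move=> bY; have zb : pi / 2 < `|Im (phase (x +i* b))| by apply: Im_phase_boundary.
  have [d d0 Hd] := (nbhs_zeroP _).1 (cvgr_gt _ (@cvg_phase (x +i* b) x0) _ zb).
  exists d => // z zx zb'; have -> : z = (x +i* b) + (0 +i* (Im z - b)).
    by rewrite -zx; case: (z) => x' y; apply/eqP; rewrite eq_complex/= addr0 addrCA subrr addr0 !eqxx.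
  by apply: Hd; rewrite /= expr0n add0r sqrtr_sqr.
have [d1 d10 H1] := near_bd Y (gtr0_norm Y0).
have [d2 d20 H2] := near_bd (- Y) (etrans (normrN _) (gtr0_norm Y0)).
pose y := Num.max 0 (Y - Num.min d1 d2).
have d0 : 0 < Num.min d1 d2 by rewrite lt_min d10.
exists y; split.
  rewrite le_max lexx/= gt_max Y0/=; lra.
move=> z zx zY zp; rewrite leNgt; apply/negP.
rewrite gt_max => /andP[_ yz].
have dd1 : Num.min d1 d2 <= d1 by rewrite ge_min lexx.
have dd2 : Num.min d1 d2 <= d2 by rewrite ge_min lexx orbT.
suff : pi / 2 < `|Im (phase z)| by rewrite ltNge zp.
have [y0|y0] := leP 0 (Im z).
  apply: H1 => //; move: zY yz; rewrite (ger0_norm y0) => zY yz.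
  by rewrite ler0_norm; lra.
apply: H2 => //; move: zY yz; rewrite (ltr0_norm y0) => zY yz.
by rewrite ger0_norm; lra.
Qed.

Variables (n : nat) (O : set 'rV[C]_n) (u : 'rV[C]_n -> \bar R).
Variables (p v : 'rV[C]_n) (x0 c0 : R).
Hypotheses (pu : psh O u) (u0 : forall z, O z -> (u z < 0)%E) (v1 : cnorm v = 1).
Hypotheses (x00 : 0 < x0) (x02 : x0 <= 1 / 2) (sx0 : slope x0 <= (beta ^+ 2 + 2)^-1).
Hypothesis (c00 : 0 < c0).
Hypothesis sliceO : forall z, 0 < Re z <= x0 -> `|Im z| < Re z * slope (Re z) -> O (p + z *: v).
Hypothesis cap : forall z, Re z = x0 -> `|Im z| <= x0 * slope x0 ->
  `|Im (phase z)| <= pi / 2 -> (u (p + z *: v) <= (- c0)%:E)%E.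

(** On the cap [Re (phase z) >= - K], so this scaling keeps the barrier at most [c0] there. *)
Let kappa := c0 * expR (- K).

Let kappa0 : 0 < kappa. Proof. by rewrite mulr_gt0// expR_gt0. Qed.

Lemma slice_estimate_eps (eps t : R) : 0 < eps -> 0 < t < x0 ->
  (u (p + t%:C *: v) + (kappa * expR (- (A * expR (- (beta * ln t)))))%:E <= eps%:E)%E.
Proof.
move=> eps0 /andP[t0 tx0].
(* Gives [A / 2 * P - K >= - ln (eps / kappa)], hence a barrier of at most [eps] once
   [(2 Re z)^(-beta) >= P]; the maximum with [1] makes [P] positive, so that [ln P] can be
   inverted. *)
pose P := Num.max 1 (2 * (K - ln (eps / kappa)) / A).
have A0 : 0 < A := barrierA_gt0 beta0 B0.
have K0 : 0 <= K := barrierK_ge0 beta0 B0.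
have P0 : 0 < P by rewrite lt_max ltr01.
(* [x1 <= t] keeps the axis point in [T]; the other bound amounts to [(2 x1)^(-beta) >= P]. *)
pose x1 := Num.min t (expR (- (ln P / beta)) / 2).
have x10 : 0 < x1 by rewrite lt_min t0 divr_gt0 ?expR_gt0.
have x1t : x1 <= t by rewrite ge_min lexx.
have x1P : P <= expR (- (beta * ln (2 * x1))).
  rewrite -[leLHS]lnK ?posrE// ler_expR lerNr.
  have : 2 * x1 <= expR (- (ln P / beta)).
    have : x1 <= expR (- (ln P / beta)) / 2 by rewrite ge_min lexx orbT.
    lra.
  rewrite -ler_ln ?posrE ?mulr_gt0 ?expR_gt0// expRK => h.
  have : beta * ln (2 * x1) <= beta * - (ln P / beta) by rewrite ler_pM2l.
  by rewrite mulrN mulrCA divff ?gt_eqF// mulr1.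
pose F z : C := kappa%:C * cexp (- phase z).
pose T := [set z : C | [/\ x1 <= Re z, Re z <= x0, `|Im z| <= Re z * slope (Re z) &
  `|Im (phase z)| <= pi / 2]].
have Tsmall z : T z -> 0 < Re z /\ slope (Re z) <= (beta ^+ 2 + 2)^-1.
  move=> [h1 h2 _ _]; have z0 : 0 < Re z := lt_le_trans x10 h1.
  by split => //; apply: le_trans sx0; apply: ler_slope.
(* On the sides of the cusp [Im_phase_boundary] contradicts the last condition of [T], so [T],
   although closed, lies in the open cusp. *)
have Tstrict z : T z -> `|Im z| < Re z * slope (Re z).
  move=> Tz; have [z0 /slope_small[sz _ _]] := Tsmall _ Tz; have [_ _ h3 h4] := Tz.
  rewrite lt_neqAle h3 andbT; apply/negP => /eqP E.
  by have := Im_phase_boundary beta0 B0 z0 E sz; rewrite ltNge h4.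
have TO z : T z -> O (p + z *: v).
  move=> Tz; apply: sliceO; last exact: Tstrict.
  by have [? ?] := Tsmall _ Tz; have [_ ? _ _] := Tz; apply/andP.
have Tre z : T z -> A / 2 * expR (- (beta * ln (2 * Re z))) - K <= Re (phase z).
  move=> Tz; have [z0 /slope_small[_ s1 s2]] := Tsmall _ Tz; have [_ h2 h3 _] := Tz.
  by apply: Re_phase_ge => //; exact: le_trans x02.
have cvgY z : 0 < Re z -> (fun h => `|Im (z + h)| - Re (z + h) * slope (Re (z + h))) @ nbhs_zero
    --> `|Im z| - Re z * slope (Re z).
  move=> z0; have cR := cvg_Re (@cvg_shift _ z).
  apply: cvgB; first by apply: cvg_norm; exact: cvg_Im (@cvg_shift _ z).
  apply: cvgM; first exact: cR.
  apply: cvgM; last exact: cvg_cst.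
  apply: (@cvg_comp _ _ _ (fun h : C => beta * ln (Re (z + h))) (@expR R)); last first.
    exact: continuous_expR.
  apply: cvgM; first exact: cvg_cst.
  apply: (@cvg_comp _ _ _ (fun h : C => Re (z + h)) (@ln R)); first exact: cR.
  exact: continuous_ln.
have closed_le (f : C -> R) (b : R) z : (fun h => f (z + h)) @ nbhs_zero --> f z ->
    (forall e : R, 0 < e -> exists2 w, T w & normc (w - z) < e) ->
    (forall w, T w -> f w <= b) -> f z <= b.
  move=> cf zcl fb; rewrite leNgt; apply/negP => bz.
  have [e e0 He] := (nbhs_zeroP _).1 (cvgr_gt _ cf _ bz).
  have [w Tw we] := zcl _ e0.
  by have := He _ we; rewrite addrCA subrr addr0 ltNge fb.
have open_lt (f : C -> R) (b : R) z : (fun h => f (z + h)) @ nbhs_zero --> f z ->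
    f z < b -> exists2 e : R, 0 < e & forall w, normc (w - z) < e -> f w < b.
  move=> cf zb.
  have [e e0 He] := (nbhs_zeroP _).1 (cvgr_lt _ cf _ zb).
  by exists e => // w /He; rewrite addrCA subrr addr0.
have Tcl z : (forall e : R, 0 < e -> exists2 w, T w & normc (w - z) < e) -> T z.
  move=> zcl; have cR := cvg_Re (@cvg_shift _ z).
  have h1 : x1 <= Re z.
    rewrite -lerN2; apply: (closed_le (fun z => - Re z)) => //; first exact: cvgN.
    by move=> w [? _ _ _]; rewrite lerN2.
  have z0 : 0 < Re z := lt_le_trans x10 h1.
  split => //.
  - by apply: (closed_le (@Re R)) => // w [].
  - rewrite -subr_le0; apply: (closed_le (fun z => `|Im z| - Re z * slope (Re z))) => //.
      exact: cvgY.
    by move=> w [_ _ ? _]; rewrite subr_le0.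
  - apply: (closed_le (fun z => `|Im (phase z)|)) => //; first exact: cvg_phase.
    by move=> w [].
have Tt : T t%:C.
  have Imt : Im (phase t%:C) = 0.
    by rewrite Im_phase /= mul0r atan0 mulr0 sin0 mul0r oppr0.
  split; [exact: x1t|exact: ltW| |by rewrite Imt normr0 divr_ge0// pi_ge0].
  by rewrite [Im _]/= normr0; apply: mulr_ge0; [exact: ltW|exact/ltW/slope_gt0].
apply: (@le_trans _ _ (u (p + t%:C *: v) + (Re (F t%:C))%:E)%E).
  by rewrite leeD2l// lee_fin; apply: Re_barrier_real => //; exact: ltW.
have [k10 kK] : 0 <= kappa /\ kappa * expR K = c0.
  by split; [exact: ltW|rewrite /kappa -mulrA -expRD addNr expR0 mulr1].
apply: (@slice_comparison R n O u p v T F eps pu u0 v1) => //.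
- exists (2 * x0) => z Tz; have [z0 /slope_small[_ s1 _]] := Tsmall _ Tz.
  have [_ h2 h3 _] := Tz; apply: (le_trans (normc_le _)); rewrite gtr0_norm//.
  by have : Re z * slope (Re z) <= Re z * 1; [rewrite ler_pM2l|lra].
- move=> z Tz; split; first exact: TO.
  by apply: jet2_barrier => //; have [] := Tsmall _ Tz.
move=> z Tz; have [z0 _] := Tsmall _ Tz; have [h1 h2 h3 h4] := Tz.
have uz0 := u0 (TO _ Tz).
(* The bound holds on the cap ([u <= - c0]), on the truncation edge (choice of [P]) and where
   [|Im (phase z)| = pi / 2] (the barrier vanishes). Elsewhere all conditions of [T] are strict, so
   [z] is interior. *)
have [Ex|nx0] := eqVneq (Re z) x0.
  left; apply: (@le_trans _ _ ((- c0)%:E + c0%:E)%E); last by rewrite -EFinD addNr lee_fin ltW.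
  rewrite Ex in h3; apply: leeD; first exact: cap.
  rewrite lee_fin -kK -[X in expR X]opprK; apply: Re_barrier_le => //.
  by apply: le_trans (Tre _ Tz); rewrite lerDr mulr_ge0 ?expR_ge0// divr_ge0// ltW.
have [E1|nx1] := eqVneq (Re z) x1.
  left; apply: (@le_trans _ _ (0%:E + eps%:E)%E); last by rewrite add0e.
  apply: leeD; first exact: ltW.
  rewrite lee_fin.
  apply: (@le_trans _ _ (kappa * expR (- (K - ln (eps / kappa) - K)))).
    apply: Re_barrier_le => //; apply: le_trans (Tre _ Tz); rewrite E1 lerD2r.
    apply: (@le_trans _ _ (A / 2 * P)); last by rewrite ler_pM2l// divr_gt0.
    have : 2 * (K - ln (eps / kappa)) / A <= P by rewrite le_max lexx orbT.
    rewrite ler_pdivrMr//; lra.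
  rewrite (_ : - _ = ln (eps / kappa)); last by ring.
  by rewrite lnK ?posrE ?divr_gt0// mulrC divfK// gt_eqF.
have [Ep|np] := eqVneq `|Im (phase z)| (pi / 2).
  left; rewrite Re_barrier -(cos_norm (Im _)) Ep cos_pihalf !mulr0 adde0.
  by apply: le_trans (ltW uz0) _; rewrite lee_fin ltW.
right; have cR := cvg_Re (@cvg_shift _ z).
have l1 : - Re z < - x1 by rewrite ltrN2 lt_neqAle eq_sym nx1.
have l2 : Re z < x0 by rewrite lt_neqAle nx0.
have l3 : `|Im z| - Re z * slope (Re z) < 0 by rewrite subr_lt0; exact: Tstrict.
have l4 : `|Im (phase z)| < pi / 2 by rewrite lt_neqAle np.
have [e1 e10 H1] := open_lt (fun z => - Re z) _ _ (cvgN cR) l1.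
have [e2 e20 H2] := open_lt (@Re R) _ _ cR l2.
have [e3 e30 H3] := open_lt (fun z => `|Im z| - Re z * slope (Re z)) _ _ (cvgY _ z0) l3.
have [e4 e40 H4] := open_lt (fun z => `|Im (phase z)|) _ _ (cvg_phase z0) l4.
exists (Num.min (Num.min e1 e2) (Num.min e3 e4)).
  by rewrite !lt_min e10 e20 e30 e40.
move=> w; rewrite !lt_min => /andP[/andP[/H1 w1 /H2 w2] /andP[/H3 w3 /H4 w4]].
split; [by rewrite -lerN2 ltW|exact: ltW|by rewrite -subr_le0 ltW|exact: ltW].
Qed.

Lemma slice_estimate (t : R) : 0 < t < x0 ->
  (u (p + t%:C *: v) <= (- (kappa * expR (- (A * expR (- (beta * ln t))))))%:E)%E.
Proof.
move=> tx0; have Ot : O (p + t%:C *: v).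
  have /andP[t0 t1] := tx0; apply: sliceO; first by rewrite /= t0 ltW.
  by rewrite /= normr0 mulr_gt0// slope_gt0.
have H eps := @slice_estimate_eps eps t; set w := _ * expR _ in H *.
move: (u0 Ot) H; case: (u _) => [x||]// _ H; last by rewrite leNye.
rewrite lee_fin leNgt; apply/negP => h.
have xw : 0 < (x + w) / 2 by rewrite divr_gt0//; lra.
by have := H _ xw tx0; rewrite -EFinD lee_fin; lra.
Qed.

End SliceEstimate.

(** * Choice of uniform constants and the estimate on [Omega] *)

Theorem theorem1p1 (R : realType) (n : nat) (Omega : set 'rV[R[i]]_n)
    (C alpha r : R) :
  (0 < n)%N -> bounded_domain Omega -> 0 < C -> 0 < alpha -> alpha < 1 -> 0 < r ->
  cusp_condition Omega C alpha r ->
  let A := pi * C `^ (alpha^-1) / (2 * (alpha^-1 - 1)) in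
  forall rho : 'rV[R[i]]_n -> \bar R,
    psh Omega rho -> (forall z, Omega z -> (rho z < 0)%E) ->
    exists c : R, exists2 delta0 : R, 0 < c /\ 0 < delta0 &
      forall z, Omega z -> dist_bd Omega z < delta0 ->
        (rho z <= (- c * expR (- (A / (dist_bd Omega z) `^ (alpha^-1 - 1))))%:E)%E.
Proof.
move=> _ [_ [oO [_ bO]]] C0 a0 a1 r0 [d1 d10 cuspO] A rho prho rho0.
pose beta := alpha^-1 - 1; pose B := C `^ alpha^-1.
have beta0 : 0 < beta by rewrite subr_gt0 invf_gt1.
have B0 : 0 < B by rewrite powR_gt0.
pose s1 := (beta ^+ 2 + 2)^-1.
have s10 : 0 < s1 by rewrite invr_gt0 ltr_wpDl// sqr_ge0.
(* [1 / 2] is for [Re_phase_ge], [r / 4] keeps the slice within [r / 2] of the vertex, and the last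
   term is [(B * s1)^(1 / beta)], where [slope] equals [s1]. *)
pose x0 := Num.min (Num.min (1 / 2) (r / 4)) (expR (ln (B * s1) / beta)).
have x00 : 0 < x0 by rewrite !lt_min !divr_gt0//= expR_gt0.
have x02 : x0 <= 1 / 2 by rewrite !ge_min lexx.
have x0r : x0 <= r / 4 by rewrite !ge_min lexx orbT.
have sx0 : slope beta B x0 <= s1.
  have h : ln x0 * beta <= ln (B * s1).
    rewrite -ler_pdivlMr// -[leRHS]expRK ler_ln ?posrE ?expR_gt0//.
    by rewrite ge_min lexx orbT.
  rewrite /slope ler_pdivrMr// [s1 * B]mulrC -[leRHS]lnK ?posrE ?mulr_gt0//.
  by rewrite ler_expR [beta * _]mulrC.
have [_ s0le1 _] := slope_small B0 sx0.
have [y [/andP[y0 yY] capy]] := phase_cap beta0 B0 x00 sx0.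
have Yx0 := slope_cusp C0 a0 x00; rewrite -/beta -/B in Yx0.
set Y := x0 * slope beta B x0 in yY capy Yx0.
(* Midway between the cap height and the side of the cusp: the gap [y3 - y] absorbs the projection
   error [2 * eta]. *)
pose y3 := (y + Y) / 2.
have y30 : 0 <= y3 by rewrite /y3; lra.
have y3Y : C * y3 `^ alpha < x0.
  rewrite -Yx0 ltr_pM2l// gt0_ltr_powR// ?nnegrE//; rewrite /y3; lra.
(* The three bounds keep a perturbed cap in the ball of radius [r], below height [y3], and strictly
   beyond abscissa [C * y3^alpha]. *)
pose eta := Num.min (r / 4) (Num.min ((Y - y) / 4) ((x0 - C * y3 `^ alpha) / 2)).
have eta0 : 0 < eta by rewrite !lt_min !divr_gt0// subr_gt0.
have eta1 : eta <= r / 4 by rewrite ge_min lexx.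
have eta2 : eta <= (Y - y) / 4 by rewrite !ge_min lexx orbT.
have eta3 : eta <= (x0 - C * y3 `^ alpha) / 2 by rewrite !ge_min lexx !orbT.
have [c0 c00 coreb] := psh_core_bound eta0 bO prho rho0.
(* Used twice: for the caps, and for axis points with [x0 <= t]. *)
have coreO p v (z : R[i]) : cnorm v = 1 -> cusp p v C alpha `&` cball p r `<=` Omega ->
    x0 <= Re z -> `|Im z| <= y -> ComplexField.Normc.normc z <= r / 2 ->
    core Omega eta (p + z *: v).
  move=> v1 pO xz zy zr w wz; apply: pO.
  rewrite -[w](subrK (p + z *: v)) addrC; split.
    apply: cusp_perturb => //; apply: (@le_lt_trans _ _ (C * y3 `^ alpha)).
      rewrite ler_pM2l// ge0_ler_powR ?nnegrE ?(ltW a0)//.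
        by rewrite addr_ge0// mulr_ge0// cnorm_ge0.
      by move: wz; rewrite /cball /= /y3 => wz; lra.
    by move: wz; rewrite /cball /= => wz; lra.
  by apply: cball_perturb => //; move: wz; rewrite /cball /= => wz; lra.
pose K := barrierK beta B.
exists (c0 * expR (- K)), d1; first by rewrite mulr_gt0 ?expR_gt0.
move=> z Oz zd; have [p [v [t [v1 t0 zE [pbd pO zr]]]]] := cuspO z Oz zd.
have zp : cnorm (z - p) = t.
  by rewrite zE addrC addKr cnormZ v1 mulr1 normc_realc gtr0_norm.
have /andP[d0 dt] := dist_bd_gt0_le oO Oz pbd; rewrite zp in dt zr.
set d := dist_bd Omega z in d0 dt *.
have A0 : 0 < A := barrierA_gt0 beta0 B0.
have powE : A / d `^ beta = A * expR (- (beta * ln d)).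
  by rewrite /powR gt_eqF// expRN.
rewrite -/beta powE mulNr.
(* The vertex is a boundary point, so [d <= t], and the barrier value increases with the distance:
   the estimate in [t] implies the one in [d]. *)
have mono : c0 * expR (- K) * expR (- (A * expR (- (beta * ln d)))) <=
    c0 * expR (- K) * expR (- (A * expR (- (beta * ln t)))).
  rewrite ler_pM2l ?mulr_gt0 ?expR_gt0// ler_expR lerN2 ler_pM2l// ler_expR lerN2.
  by rewrite ler_pM2l// ler_ln ?posrE.
(* For [x0 <= t] the point itself has depth [eta] and [rho z <= - c0]; otherwise the slice estimate
   applies. *)
have [x0t|tx0] := leP x0 t.
  have : core Omega eta z.
    rewrite zE; apply: coreO => //=; first by rewrite normr0.
    by rewrite expr0n addr0 sqrtr_sqr gtr0_norm// ltW.
  move=> /coreb /le_trans; apply; rewrite lee_fin lerN2 -mulrA ler_piMr ?(ltW c00)//.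
  rewrite -expRD expR_le1 -opprD oppr_le0 addr_ge0 ?barrierK_ge0//.
  by rewrite mulr_ge0 ?expR_ge0// ltW.
rewrite zE; apply: (@le_trans _ _ (- (c0 * expR (- K) * expR (- (A * expR (- (beta * ln t))))))%:E); last first.
  by rewrite lee_fin lerN2.
apply: (@slice_estimate R beta B beta0 B0 n Omega rho p v x0 c0) => //; last by rewrite t0.
  move=> w /andP[w0 wx0] wY; apply: pO; rewrite -[p + _]addr0; split.
    apply: cusp_perturb => //; rewrite cnorm0 mulr0 addr0 subr0.
    have := slope_cusp C0 a0 w0; rewrite -/beta -/B => E; rewrite -[ltRHS]E.
    by rewrite ltr_pM2l// gt0_ltr_powR// ?nnegrE// (le_trans _ (ltW wY)).
  apply: cball_perturb => //; rewrite cnorm0 addr0; apply: (le_lt_trans (normc_le _)).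
  rewrite gtr0_norm//.
  have : Re w * slope beta B (Re w) <= Re w * 1.
    rewrite ler_pM2l//; apply: le_trans s0le1; exact: ler_slope.
  lra.
move=> w wx wY wp; apply: coreb; apply: coreO => //; first by rewrite wx.
  exact: capy.
apply: (le_trans (normc_le _)); rewrite wx gtr0_norm//.
have : Y <= x0 * 1 by rewrite ler_pM2l.
move: wY; rewrite -/Y.
lra.
Qed.
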